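(* Let $K$ be a field and let $(X,\sigma)$ be a Deaconu--Renault system with $X$ totally disconnected. The following are equivalent: (1) $X$ is finite and $\operatorname{dom}(\sigma^{|X|})=\emptyset$; (2) $G(X,\sigma)$ is finite; (3) $A_K(G(X,\sigma))$ is Artinian; (4) $A_K(G(X,\sigma))$ is semisimple.
   Context: A Deaconu--Renault system is a pair $(X,\sigma)$ where $X$ is a locally compact Hausdorff space and $\sigma:\operatorname{dom}(\sigma)\to X$ is a local homeomorphism defined on an open subset $\operatorname{dom}(\sigma)\subseteq X$. Set $\operatorname{dom}(\sigma^0)=X$, $\sigma^0=\mathrm{id}_X$, $\operatorname{dom}(\sigma^{n+1})=\{x\in\operatorname{dom}(\sigma^n):\sigma^n(x)\in\operatorname{dom}(\sigma)\}$ and $\sigma^{n+1}(x)=\sigma(\sigma^n(x))$. The Deaconu--Renault groupoid is $G(X,\sigma)=\{(x,k,y)\in X\times\mathbb Z\times X:\exists\, m,n\ge0,\ k=m-n,\ x\in\operatorname{dom}(\sigma^m),\ y\in\operatorname{dom}(\sigma^n),\ \sigma^m(x)=\sigma^n(y)\}$, with $r(x,k,y)=x$, $s(x,k,y)=y$, $(x,k,y)(y,\ell,z)=(x,k+\ell,z)$, $(x,k,y)^{-1}=(y,-k,x)$, unit space identified with $X$ via $x\leftrightarrow(x,0,x)$, and topology generated by the sets $Z(U,m,n,V)=\{(x,m-n,y): x\in U,\ y\in V,\ \sigma^m(x)=\sigma^n(y)\}$, with $m,n\ge0$ and $U\subseteq\operatorname{dom}(\sigma^m)$, $V\subseteq\operatorname{dom}(\sigma^n)$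 open such that $\sigma^m|_U$, $\sigma^n|_V$ are homeomorphisms onto their images. When $X$ is totally disconnected this is an ample Hausdorff groupoid. The Steinberg algebra of an ample Hausdorff groupoid $G$ is $A_K(G)=\mathrm{span}_K\{1_U:U\subseteq G\text{ a compact open bisection}\}$ with convolution product, determined by $1_U*1_V=1_{UV}$ (a bisection is a set on which $r$ and $s$ are injective). Artinian means the descending chain condition on one-sided ideals (left and right conditions are equivalent here, since inversion in the groupoid induces an anti-automorphism of the algebra). A ring is semisimple if it is unital and semisimple as a left module over itself (semisimple Artinian). *)

(* Defs.v *)
From HB Require Import structures.
From mathcomp Require Import all_boot all_order all_algebra finmap.
From mathcomp Require Import zify.
From mathcomp Require Import all_classical all_reals all_analysis.

Set Implicit Arguments.
Unset Strict Implicit.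
Unset Printing Implicit Defensive.

Import Order.TTheory GRing.Theory Num.Theory.
Local Open Scope classical_set_scope.
Local Open Scope ring_scope.

(* The inverse homeomorphism [f @` U -> U] is given as the restriction of a
   total map [g]; its values outside [f @` U] are irrelevant. *)
Definition homeo_onto_image (X : topologicalType) (f : X -> X) (U : set X) :=
  exists g : X -> X, [/\ {within U, continuous f}, {in U, cancel f g}
                       & {within f @` U, continuous g}].

(* The partial map sigma is encoded by a total function together with its
   domain; the values of [dr_map] outside [dr_dom] are never used. *)
Record dr_system (X : topologicalType) := DRSystem {
  dr_dom : set X ;
  dr_map : X -> X ;
  dr_locally_compact : locally_compact [set: X] ;
  dr_hausdorff : hausdorff_space X ;
  dr_dom_open : open dr_dom ;
  dr_local_homeo : forall x, dr_dom x -> exists U : set X,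
    [/\ open U, U x, U `<=` dr_dom, open (dr_map @` U)
      & homeo_onto_image dr_map U]
}.

Section DeaconuRenault.
Variables (X : topologicalType) (S : dr_system X).

Definition iter_map (n : nat) : X -> X := iter n (dr_map S).

Fixpoint iter_dom (n : nat) : set X :=
  if n is m.+1 then [set x | iter_dom m x /\ dr_dom S (iter_map m x)]
  else [set: X].

Definition dr_arrows : set (X * int * X) :=
  [set g | exists m n : nat,
     [/\ g.1.2 = m%:Z - n%:Z, iter_dom m g.1.1, iter_dom n g.2
       & iter_map m g.1.1 = iter_map n g.2]].

Record dr_groupoid := DRArrow {
  dr_arrow : X * int * X ;
  dr_arrowP : dr_arrow \in dr_arrows
}.

HB.instance Definition _ := [isSub for dr_arrow].
HB.instance Definition _ := [Choice of dr_groupoid by <:].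

Definition dr_rng (g : dr_groupoid) : X := (dr_arrow g).1.1.
Definition dr_deg (g : dr_groupoid) : int := (dr_arrow g).1.2.
Definition dr_src (g : dr_groupoid) : X := (dr_arrow g).2.

Lemma iter_mapD m n x : iter_map (m + n) x = iter_map m (iter_map n x).
Proof. exact: iterD. Qed.

Lemma iter_domD m n x :
  iter_dom (m + n) x <-> iter_dom n x /\ iter_dom m (iter_map n x).
Proof.
elim: m => [|m IH]; first by split=> [|[]].
rewrite addSn /=; split=> [[/IH [? ?] d]|[? [? d]]].
  by split=> //; split=> //; rewrite -iter_mapD.
by split; [exact/IH|rewrite iter_mapD].
Qed.

Lemma dr_mul_subproof (g h : dr_groupoid) : dr_src g = dr_rng h ->
  (dr_rng g, dr_deg g + dr_deg h, dr_src h) \in dr_arrows.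
Proof.
case: g h => [[[x k] y] /= gP] [[[y' l] z] /= hP].
rewrite /dr_src /dr_rng /dr_deg /= => yy'; subst y'.
move: gP hP; rewrite !inE => -[m [n /= [-> xm yn exy]]].
move=> [p [q /= [-> yp zq eyz]]].
have [np|/ltnW pn] := leqP n p.
- exists (m + (p - n))%N, q; split=> //=; first by lia.
  + rewrite addnC; apply/iter_domD; split=> //.
    by rewrite exy; have := yp; rewrite -{1}(subnK np) => /iter_domD[].
  + by rewrite -eyz addnC iter_mapD exy -iter_mapD subnK.
- exists m, (q + (n - p))%N; split=> //=; first by lia.
  + rewrite addnC; apply/iter_domD; split=> //.
    by rewrite -eyz; have := yn; rewrite -{1}(subnK pn) => /iter_domD[].
  + by rewrite exy addnC iter_mapD -eyz -iter_mapD subnK.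
Qed.

Definition dr_mul (g h : dr_groupoid) (gh : dr_src g = dr_rng h) : dr_groupoid :=
  DRArrow (dr_mul_subproof gh).

(* The sets Z(U, m, n, V), without the conditions on U and V. *)
Definition dr_cylinder (U : set X) (m n : nat) (V : set X) : set dr_groupoid :=
  [set g | [/\ U (dr_rng g), dr_deg g = m%:Z - n%:Z, V (dr_src g)
             & iter_map m (dr_rng g) = iter_map n (dr_src g)]].

Definition dr_subbase : set (set dr_groupoid) :=
  [set W | exists U m n V,
     [/\ [/\ open U, U `<=` iter_dom m & homeo_onto_image (iter_map m) U],
         [/\ open V, V `<=` iter_dom n & homeo_onto_image (iter_map n) V]
       & W = dr_cylinder U m n V]].

HB.instance Definition _ :=
  isSubBaseTopological.Build dr_groupoid dr_subbase id.

Definition compact_open_bisection (U : set dr_groupoid) :=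
  [/\ compact U, open U, set_inj U dr_rng & set_inj U dr_src].

End DeaconuRenault.

Section SteinbergAlgebra.
Variables (K : fieldType) (X : topologicalType) (S : dr_system X).
Local Notation G := (dr_groupoid S).

Definition steinberg : set (G -> K) :=
  [set f | exists (n : nat) (c : 'I_n -> K) (U : 'I_n -> set G),
     (forall i, compact_open_bisection (U i)) /\
     f = (fun g => \sum_(i < n) c i * \1_(U i) g)].

(* For f1 and f2 in [steinberg] the sum has finitely many nonzero terms
   (a finitely supported sum over an infinite support would be 0). *)
Definition convolution (f1 f2 : G -> K) : G -> K := fun g =>
  \sum_(p \in [set p : G * G |
                 exists gh : dr_src p.1 = dr_rng p.2, dr_mul gh = g])
    f1 p.1 * f2 p.2.

End SteinbergAlgebra.

(* Chain conditions and semisimplicity for a possibly non-unital ring, given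
   as a subset [A] of an additive group [V] with a multiplication [mul] defined
   on [V] (only its restriction to [A] is relevant). *)
Section NonUnitalRings.
Variables (V : zmodType) (mul : V -> V -> V) (A : set V).

Definition additive_subgroup (I : set V) :=
  [/\ I `<=` A, I 0 & forall x y, I x -> I y -> I (x - y)].

Definition left_ideal (I : set V) :=
  additive_subgroup I /\ forall a x, A a -> I x -> I (mul a x).

Definition right_ideal (I : set V) :=
  additive_subgroup I /\ forall a x, A a -> I x -> I (mul x a).

Definition descending_chain_condition (P : set V -> Prop) :=
  forall I : nat -> set V, (forall n, P (I n)) ->
    (forall n, I n.+1 `<=` I n) ->
    exists N, forall n, (N <= n)%N -> I n = I N.

Definition left_artinian := descending_chain_condition left_ideal.

Definition right_artinian := descending_chain_condition right_ideal.

Definition unital :=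
  exists2 e, A e & forall a, A a -> mul e a = a /\ mul a e = a.

(* The submodules of A as a left module over itself are its left ideals. *)
Definition simple_left_ideal (M : set V) :=
  [/\ left_ideal M, M <> [set 0]
    & forall I, left_ideal I -> I `<=` M -> I = [set 0] \/ I = M].

(* A is unital and the (internal) direct sum of a family of simple left
   A-submodules. *)
Definition semisimple :=
  unital /\
  exists (J : choiceType) (M : J -> set V),
    (forall j, simple_left_ideal (M j)) /\
    forall a, A a -> exists! x : J -> V,
      [/\ forall j, M j (x j), finite_set [set j | x j != 0]
        & a = \sum_(j \in [set: J]) x j].

End NonUnitalRings.

(* Main.v *)
Require Import Defs.
From mathcomp Require Import all_boot all_order all_algebra finmap.
From mathcomp Require Import zify ring.
From mathcomp Require Import all_classical all_reals all_analysis.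

(** The equivalence rests on the degree of an arrow and on two families of left
    ideals of the Steinberg algebra.

    If [X] is finite and some iterate of the map has empty domain, then only
    finitely many exponents occur in arrows, so the groupoid is finite
    ([finite_groupoid]). A finite groupoid of this kind is principal: a loop of
    nonzero degree would have infinitely many powers. It is also discrete, so its
    algebra consists of all functions on the arrows and is a product of full
    matrix algebras, one for each orbit. Its columns, that is the spaces of
    functions supported on the arrows with a given source, are simple left ideals
    and give a semisimple decomposition ([finite_groupoid_semisimple]).

    A semisimple ring is a sum of finitely many simple left ideals, because its
    unit lies in such a sum; hence it is left Artinian
    ([semisimple_left_artinian]). Inversion of arrows induces an
    anti-automorphism of the algebra, so the left and right chain conditions
    agree ([left_right_artinian]).

    It remains to see what the chain condition forces. The functions that vanish
    on all arrows with source in a given set form a left ideal. If [X] were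
    infinite, adding points to this set one at a time would give a strictly
    decreasing chain, since points of [X] have small compact open neighbourhoods
    ([left_artinian_finite]). If [X] is finite and [iter_dom S #|X|] is not empty,
    the pigeonhole principle gives a loop [g] of positive degree at some point
    [y]. For a positive integer [q], the functions whose sum over each set of
    arrows from [y] to [x] with degree in a fixed class modulo [q] is zero form a
    left ideal. Doubling [q] shrinks this ideal, strictly so along the degrees of
    the powers [g ^ (2 ^ n)]: the unit at [y] minus such a power is a witness
    ([left_artinian_aperiodic]).

    That these subspaces are ideals presupposes that the algebra is closed under
    convolution, that is, that a product of compact open bisections is one
    ([prod_set_bisection]). Openness of the product comes from the openness of the
    iterates of the local homeomorphism, and compactness is read off on ranges,
    since the range map is continuous and open. *)

Set Implicit Arguments.
Unset Strict Implicit.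
Unset Printing Implicit Defensive.

Import Order.TTheory GRing.Theory Num.Theory.
Local Open Scope classical_set_scope.
Local Open Scope ring_scope.

(** * Compact open neighbourhoods in totally disconnected spaces *)

Section CompactOpenNeighbourhoods.
Variable X : topologicalType.
Hypothesis hX : hausdorff_space X.

Definition clopen_in (C : set X) (x : X) : set (set X) :=
  [set E | [/\ E `<=` C, E x, closed E & closed (C `\` E)]].

Definition quasicomponent C x := \bigcap_(E in clopen_in C x) E.

Lemma clopen_inI C x D E :
  clopen_in C x D -> clopen_in C x E -> clopen_in C x (D `&` E).
Proof.
move=> [DC Dx cD cD'] [EC Ex cE cE']; split=> //.
- by move=> z [/DC].
- exact: closedI.
- by rewrite setDIr; exact: closedU.
Qed.

(** The sets [E `\` O], for [E] relatively clopen, are closed in a compact set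
    and closed under intersection; if none were empty they would have a common
    point, which would lie in the quasicomponent but not in [O]. *)
Lemma quasicomponent_sub_open C x O : compact C -> closed C -> C x -> open O ->
  quasicomponent C x `<=` O -> exists2 E, clopen_in C x E & E `<=` O.
Proof.
move=> kC cC Cx oO QO; apply: contrapT => nE.
have QC : clopen_in C x C by split=> //; rewrite setDv; exact: closed0.
pose F := filter_from (clopen_in C x) (fun E => E `\` O).
have FF : ProperFilter F.
  apply: filter_from_proper; last first.
    move=> E QE; apply: contrapT => /nonemptyPn EO; apply: nE; exists E => // z Ez.
    by apply: contrapT => nOz; have : (E `\` O) z by []; rewrite EO.
  apply: filter_from_filter; first by exists C.
  move=> D E QD QE; exists (D `&` E); first exact: clopen_inI.
  by move=> z [[Dz Ez] nOz].
have [|p [Cp clp]] := kC F FF; first by exists C => // z [].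
have pE E : clopen_in C x E -> (E `\` O) p.
  move=> QE; have [_ _ cE _] := QE.
  have : closed (E `\` O) by apply: closedI => //; exact: open_closedC.
  apply; move: clp; rewrite clusterE; apply.
  by exists E.
have [_ nOp] := pE _ QC; apply: nOp; apply: QO => E QE.
by have [] := pE _ QE.
Qed.

(** If the quasicomponent were the union of two disjoint nonempty closed pieces,
    disjoint open neighbourhoods of these would cut some relatively clopen
    neighbourhood of [x] into two relatively clopen halves, and the half that
    contains [x] would miss one of the pieces. The interior condition on the
    larger compact set [K] gives the separation of the two pieces. *)
Lemma quasicomponent_connected C x : compact C -> closed C -> C x ->
  (exists2 K, compact K & C `<=` K°) -> connected (quasicomponent C x).
Proof.
move=> kC cC Cx [K kK CK] B [b Bb] [] O oO BO [D cD BD].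
have QC : quasicomponent C x `<=` C.
  by move=> z Qz; apply: (Qz C); split; rewrite ?setDv //; exact: closed0.
have cQ : closed (quasicomponent C x) by apply: closed_bigI => E [].
have cB : closed B by rewrite BD; exact: closedI.
have cB' : closed (quasicomponent C x `&` ~` O).
  by apply: closedI => //; exact: open_closedC.
have BK : B `<=` K° by rewrite BO => z [/QC/CK].
have nB : set_nbhs B (~` (quasicomponent C x `&` ~` O)).
  apply/set_nbhsP; exists (~` (quasicomponent C x `&` ~` O)); split=> //.
    exact: closed_openC.
  by rewrite BO => z [Qz Oz] [].
have snB : filter_from (set_nbhs B) closure (~` (quasicomponent C x `&` ~` O)).
  exact: (@compact_normal_local X K hX kK B BK cB).
have [V /set_nbhsP[W [oW BW WV]] VB'] := snB.
pose O1 := W; pose O2 := ~` closure V.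
have O12 z : O1 z -> O2 z -> False.
  by move=> /WV /subset_closure + nV.
have QO : quasicomponent C x `<=` O1 `|` O2.
  move=> z Qz; have [Oz|nOz] := pselect (O z); first by left; apply: BW; rewrite BO.
  by right=> /VB'; apply.
have oO2 : open O2 by apply: closed_openC; exact: closed_closure.
have [E [EC Ex cE cE'] EO] := quasicomponent_sub_open kC cC Cx (openU oW oO2) QO.
(* the half of E that contains x is again relatively clopen *)
have half U V' : open U -> open V' -> (forall z, U z -> V' z -> False) ->
    E `<=` U `|` V' -> U x -> quasicomponent C x `<=` U.
  move=> oU oV' UV' EUV Ux z Qz.
  have QEU : clopen_in C x (E `&` U).
    split=> //; first by move=> t [/EC].
    - have -> : E `&` U = E `&` ~` V'.
        apply/seteqP; split=> t [Et]; first by move=> Ut; split=> // /(UV' _ Ut).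
        by move=> nV; split=> //; have [] := EUV _ Et.
      by apply: closedI => //; exact: open_closedC.
    - have -> : C `\` (E `&` U) = (C `\` E) `|` (E `&` ~` U).
        apply/seteqP; split=> t.
          move=> [Ct nEU]; have [Et|nEt] := pselect (E t); last by left.
          by right; split=> // Ut; apply: nEU.
        by move=> [[Ct nEt]|[Et nUt]]; split; [|by case|exact: EC|by case].
      by apply: closedU => //; apply: closedI => //; exact: open_closedC.
  by have [] := Qz _ QEU.
have [/(half _ _ oW oO2 O12 EO) QW|nWx] := pselect (O1 x).
  rewrite BO; apply/seteqP; split=> [z []//|z Qz]; split=> //.
  apply: contrapT => nOz; have := QW _ Qz => /WV /subset_closure /VB'.
  by apply.
have O2x : O2 x by have [] := EO _ Ex.
have /half : forall z, O2 z -> O1 z -> False by move=> z /[swap]; exact: O12.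
move=> /(_ oO2 oW); rewrite setUC => /(_ EO O2x) QO2.
exfalso; apply: (O12 b); first exact: BW.
by apply: QO2; move: Bb; rewrite BO => -[].
Qed.

(** In a compact neighbourhood of [x] the quasicomponent of [x] is connected,
    hence reduced to [x], so there are arbitrarily small relatively clopen
    neighbourhoods of [x]; those inside the interior are open. *)
Lemma compact_open_nbhs (x : X) (O : set X) :
  locally_compact [set: X] -> totally_disconnected [set: X] ->
  open O -> O x -> exists E : set X, [/\ compact E, open E, E x & E `<=` O].
Proof.
move=> lcX tdX oO Ox.
have [K' nK' [kK cK]] := lcX x I.
have {nK'} nK : nbhs x K'.
  by move: nK'; rewrite /within /= /prop_near1; apply: filterS => t; apply.
have [C0 /= nC0 C0K] : filter_from (nbhs x) closure (K'°).
  apply: (compact_regular hX kK nK); exact: nbhs_interior.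
(* a closed neighbourhood C of x inside the interior of K', so that both are
   available for quasicomponent_connected *)
pose C := closure C0.
have CK : C `<=` K'° by exact: C0K.
have cC : closed C by exact: closed_closure.
have kC : compact C.
  by apply: subclosed_compact cC kK _ => z /CK /interior_subset.
have nC : nbhs x C by apply: filterS nC0; exact: subset_closure.
have Cx := nbhs_singleton nC.
have conn := quasicomponent_connected kC cC Cx (ex_intro2 _ _ K' kK CK).
have Qx : quasicomponent C x `<=` [set x].
  by rewrite -(tdX x I) => z Qz; exists (quasicomponent C x) => //; split=> // E [].
have [|E [EC Ex cE cE'] EO] := quasicomponent_sub_open kC cC Cx
    (openI oO (@open_interior _ C)).
  by move=> z /Qx ->; split=> //.
exists E; split=> //.
- exact: subclosed_compact cE kC EC.
- have -> : E = C° `&` ~` (C `\` E).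
    apply/seteqP; split=> t; first by move=> Et; split; [have [] := EO _ Et|case].
    move=> [/interior_subset Ct nCE]; apply: contrapT => nEt; exact: nCE.
  by apply: openI; [exact: open_interior|exact: closed_openC].
- by move=> z /EO[].
Qed.
End CompactOpenNeighbourhoods.

(** * Iterates of a partial local homeomorphism *)

Lemma open_pointwise (T : topologicalType) (W : set T) :
  (forall x, W x -> exists O, [/\ open O, O x & O `<=` W]) -> open W.
Proof.
move=> h; rewrite openE => x /h[N [oN Nx NW]].
by apply: (filterS NW); apply: open_nbhs_nbhs; split.
Qed.

Section LocalHomeomorphism.
Variables (X : topologicalType) (f : X -> X) (U : set X).
Hypotheses (oU : open U) (ofU : open (f @` U)) (hf : homeo_onto_image f U).

Lemma homeo_set_inj : set_inj U f.
Proof.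
have [g [_ gK _]] := hf.
by move=> x y /gK fx /gK fy e; rewrite -fx -fy e.
Qed.

Lemma homeo_preimage_open O : open O -> open (U `&` f @^-1` O).
Proof.
have [g [fc _ _]] := hf; move: fc; rewrite continuous_open_subspace//.
by move=> /(continuous_inP _ oU); apply.
Qed.

Lemma homeo_image_open O : open O -> O `<=` U -> open (f @` O).
Proof.
have [g [_ gK gc]] := hf; move: gc; rewrite continuous_open_subspace//.
move=> /(continuous_inP _ ofU)/[apply] + OU.
congr open; apply/seteqP; split=> [_ [[x Ux <-]]|_ [x Ox <-]].
  by rewrite /= gK ?inE// => Ox; exists x.
by have Ux := OU _ Ox; split; [exists x|rewrite /= gK ?inE].
Qed.

End LocalHomeomorphism.

Section Iterates.
Variables (X : topologicalType) (S : dr_system X).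
Local Notation dom := (iter_dom S).
Local Notation it := (iter_map S).

Lemma iter_preimage_open n O : open O -> open (dom n `&` it n @^-1` O).
Proof.
elim: n O => [|n IHn] O oO; first by rewrite setTI.
have -> : dom n.+1 `&` it n.+1 @^-1` O =
    dom n `&` it n @^-1` (dr_dom S `&` dr_map S @^-1` O).
  by apply/seteqP; split=> x; [move=> [[? ?] ?]|move=> [? [? ?]]].
apply: IHn; apply: open_pointwise => x [dx Ox].
have [U [oU Ux Ud ofU hU]] := dr_local_homeo dx.
exists (U `&` dr_map S @^-1` O); split=> //; first exact: homeo_preimage_open.
by move=> y [/Ud].
Qed.

Lemma iter_image_open n O : open O -> O `<=` dom n -> open (it n @` O).
Proof.
elim: n O => [|n IHn] O oO On; first by rewrite image_id.
have -> : it n.+1 @` O = dr_map S @` (it n @` O) by rewrite image_comp.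
have {IHn}oI : open (it n @` O) by apply: IHn => // x /On [].
have Id : it n @` O `<=` dr_dom S by move=> _ [x /On [_ ?] <-].
apply: open_pointwise => _ [x Ix <-].
have [U [oU Ux Ud ofU hU]] := dr_local_homeo (Id _ Ix).
exists (dr_map S @` (it n @` O `&` U)); split.
- by apply: (homeo_image_open ofU hU); [exact: openI|move=> y []].
- by exists x.
- by move=> _ [y [Iy _] <-]; exists y.
Qed.

(** For an open set, the conditions imposed on [U] in [Z(U, m, n, V)] amount to
    injectivity, because iterates are continuous and open; see
    [injectivity_domain_homeo]. *)
Definition injectivity_domain n (U : set X) :=
  [/\ open U, U `<=` dom n & set_inj U (it n)].

Lemma injectivity_domainI n U O :
  injectivity_domain n U -> open O -> injectivity_domain n (U `&` O).
Proof.
move=> [oU Ud Ui] oO; split; [exact: openI|by move=> x [/Ud]|].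
by move=> x y; rewrite !inE => -[Ux _] [Uy _]; apply: Ui; rewrite inE.
Qed.

Lemma injectivity_domain_at n x O : dom n x -> open O -> O x ->
  exists U, [/\ injectivity_domain n U, U x & U `<=` O].
Proof.
move=> dx oO Ox; suff [U [hU Ux]] : exists U, injectivity_domain n U /\ U x.
  exists (U `&` O); split=> //; exact: injectivity_domainI.
elim: n dx => [_|n IHn /= [/IHn [U [[oU Ud Ui] Ux]] dx]].
  by exists setT; split=> //; split=> //; exact: openT.
have [V [oV Vx Vd ofV hV]] := dr_local_homeo dx.
exists (U `&` (dom n `&` it n @^-1` V)); split; last first.
  by split=> //; split=> //; exact: Ud.
split.
- by apply: openI => //; exact: iter_preimage_open.
- by move=> y [Uy [dy Vy]]; split=> //; exact: Vd.
- move=> y z; rewrite !inE => -[Uy [_ Vy]] [Uz [_ Vz]] e.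
  by apply: Ui; rewrite ?inE//; apply: (homeo_set_inj hV); rewrite ?inE.
Qed.

Lemma injectivity_domain_homeo n U :
  injectivity_domain n U -> homeo_onto_image (it n) U.
Proof.
move=> [oU Ud Ui].
pose g z := if pselect (exists2 x, U x & it n x = z) is left e
            then projT1 (cid2 e) else z.
have gK : {in U, cancel (it n) g}.
  move=> x; rewrite inE => Ux; rewrite /g; case: pselect => [e|]; last first.
    by case; exists x.
  by case: cid2 => y /= Uy; apply: Ui; rewrite inE.
exists g; split=> //.
  rewrite continuous_open_subspace//; apply/(continuous_inP _ _) => // O oO.
  have -> : U `&` it n @^-1` O = U `&` (dom n `&` it n @^-1` O).
    by apply/seteqP; split=> x [Ux]; [split=> //; split=> //; exact: Ud|case].
  by apply: openI => //; exact: iter_preimage_open.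
have oI := iter_image_open oU Ud.
rewrite continuous_open_subspace//; apply/(continuous_inP _ _) => // O oO.
have -> : it n @` U `&` g @^-1` O = it n @` (U `&` O).
  apply/seteqP; split=> [_ [[x Ux <-]]|_ [x [Ux Ox] <-]].
    by rewrite /= gK ?inE// => Ox; exists x.
  by split; [exists x|rewrite /= gK ?inE].
by apply: iter_image_open; [exact: openI|move=> x [/Ud]].
Qed.

End Iterates.

(** * Topology of the groupoid *)

Section Groupoid.
Variables (X : topologicalType) (S : dr_system X).
Local Notation G := (dr_groupoid S).
Local Notation dom := (iter_dom S).
Local Notation it := (iter_map S).
Local Notation rng := (@dr_rng X S).
Local Notation src := (@dr_src X S).
Local Notation deg := (@dr_deg X S).
Local Notation cyl := (@dr_cylinder X S).

Lemma arrow_ext (g h : G) :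
  rng g = rng h -> deg g = deg h -> src g = src h -> g = h.
Proof.
case: g => -[[x k] y] gP; case: h => -[[x' k'] y'] hP.
rewrite /dr_rng /dr_deg /dr_src /= => e1 e2 e3; subst x' k' y'.
by congr DRArrow; exact: Prop_irrelevance.
Qed.

Lemma arrow_witness (g : G) : exists m n : nat,
  [/\ deg g = m%:Z - n%:Z, dom m (rng g), dom n (src g)
    & it m (rng g) = it n (src g)].
Proof. by have := dr_arrowP g; rewrite inE. Qed.

Lemma arrow_exists m n x y : dom m x -> dom n y -> it m x = it n y ->
  exists g : G, [/\ rng g = x, deg g = m%:Z - n%:Z & src g = y].
Proof.
move=> dx dy e.
have P : (x, m%:Z - n%:Z, y) \in dr_arrows S by rewrite inE; exists m, n.
by exists (DRArrow P).
Qed.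

Lemma inv_subproof (g : G) : (src g, - deg g, rng g) \in dr_arrows S.
Proof.
have [m [n [d dm dn e]]] := arrow_witness g.
by rewrite inE; exists n, m; rewrite /= d opprB.
Qed.

Definition dr_inv (g : G) : G := DRArrow (inv_subproof g).

Lemma rng_inv g : rng (dr_inv g) = src g. Proof. by []. Qed.
Lemma src_inv g : src (dr_inv g) = rng g. Proof. by []. Qed.
Lemma deg_inv g : deg (dr_inv g) = - deg g. Proof. by []. Qed.

Lemma dr_invK : involutive dr_inv.
Proof. by move=> g; apply: arrow_ext => //; rewrite !deg_inv opprK. Qed.

Lemma dr_inv_inj : injective dr_inv. Proof. exact: can_inj dr_invK. Qed.

Lemma unit_subproof x : (x, 0, x) \in dr_arrows S.
Proof. by rewrite inE; exists 0%N, 0%N. Qed.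

Definition unit_arrow x : G := DRArrow (unit_subproof x).

(** A relational form of the product, which unlike [dr_mul] does not depend on a
    proof of composability. *)
Definition composes (u v g : G) :=
  [/\ src u = rng v, rng g = rng u, src g = src v & deg g = deg u + deg v].

Lemma composesP u v g :
  composes u v g <-> exists uv : src u = rng v, dr_mul uv = g.
Proof.
split=> [[uv r s d]|[uv <-]]; last by split.
by exists uv; apply: arrow_ext.
Qed.

Lemma composes_inv u v g : composes u v g -> composes (dr_inv v) (dr_inv u) (dr_inv g).
Proof. by move=> [e r s d]; split=> //; rewrite !deg_inv d opprD addrC. Qed.

Lemma composes_exists u v : src u = rng v -> exists g, composes u v g.
Proof. by move=> uv; exists (dr_mul uv); apply/composesP; exists uv. Qed.

Lemma composes_divr g v : src g = src v -> exists u, composes u v g.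
Proof.
move=> e; have [|u [e' r s d]] := @composes_exists g (dr_inv v); first exact: e.
by exists u; split=> //; rewrite d deg_inv subrK.
Qed.

Lemma composes_divl g u : rng g = rng u -> exists v, composes u v g.
Proof.
move=> e; have [v /composes_inv] := @composes_divr (dr_inv g) (dr_inv u) e.
by rewrite !dr_invK => h; exists (dr_inv v).
Qed.

Lemma composes_fun u v g g' : composes u v g -> composes u v g' -> g = g'.
Proof. by move=> [_ r s d] [_ r' s' d']; apply: arrow_ext; congruence. Qed.

Lemma composes_injr u v v' g : composes u v g -> composes u v' g -> v = v'.
Proof.
move=> [e r s d] [e' r' s' d']; apply: arrow_ext; try congruence.
by apply: (@addrI _ (deg u)); rewrite -d -d'.
Qed.

Lemma cylinder_open U m n V : injectivity_domain S m U ->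
  injectivity_domain S n V -> open (cyl U m n V).
Proof.
move=> hU hV.
have sW : dr_subbase (cyl U m n V).
  exists U, m, n, V; split=> //.
    by have [? ? _] := hU; split=> //; exact: injectivity_domain_homeo.
  by have [? ? _] := hV; split=> //; exact: injectivity_domain_homeo.
exists [set cyl U m n V].
  move=> _ ->; exists [fset cyl U m n V]%fset.
    by move=> W; rewrite in_fset1 => /eqP ->; rewrite inE.
  by rewrite set_fset1 bigcap_set1.
by rewrite bigcup_set1.
Qed.

Lemma inv_cylinder U m n V g : cyl U m n V (dr_inv g) <-> cyl V n m U g.
Proof.
split=> [[]|[]]; rewrite ?rng_inv ?src_inv ?deg_inv => Ug d Vg e; split=> //.
  by rewrite -[deg g]opprK d opprB.
by rewrite deg_inv d opprB.
Qed.

(** When the degrees agree, the smaller exponents already force the equation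
    for the larger ones, so cylinders around a common point intersect in a
    cylinder. *)
Lemma cylinderI U m n V U' p q V' : (m <= p)%N -> (m + q = p + n)%N ->
  cyl (U `&` U') m n (V `&` V') `<=` cyl U m n V `&` cyl U' p q V'.
Proof.
move=> mp e g [[Ug U'g] d [Vg V'g] eg]; split=> //; split=> //.
  by rewrite d; lia.
have -> : p = ((p - m) + m)%N by lia.
have -> : q = ((p - m) + n)%N by lia.
by rewrite !iter_mapD eg.
Qed.

Definition cylinder_at (g : G) (W : set G) := exists U m n V,
  [/\ injectivity_domain S m U, injectivity_domain S n V,
      W = cyl U m n V & W g].

Lemma cylinder_at_exists g O O' : open O -> O (rng g) -> open O' -> O' (src g) ->
  exists2 W, cylinder_at g W & forall h, W h -> O (rng h) /\ O' (src h).
Proof.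
move=> oO Og oO' Og'; have [m [n [d dm dn e]]] := arrow_witness g.
have [U [hU Ug UO]] := injectivity_domain_at dm oO Og.
have [V [hV Vg VO]] := injectivity_domain_at dn oO' Og'.
by exists (cyl U m n V) => [|h [/UO ? _ /VO ? _]//]; exists U, m, n, V; split.
Qed.

Lemma cylinder_atI g W W' : cylinder_at g W -> cylinder_at g W' ->
  exists2 W'', cylinder_at g W'' & W'' `<=` W `&` W'.
Proof.
wlog suff main : W W' / forall U m n V p q U' V',
    injectivity_domain S m U -> injectivity_domain S n V ->
    injectivity_domain S p U' -> injectivity_domain S q V' ->
    W = cyl U m n V -> W' = cyl U' p q V' -> W g -> W' g -> (m <= p)%N ->
    exists2 W'', cylinder_at g W'' & W'' `<=` W `&` W'.
  move=> [U [m [n [V [hU hV eW Wg]]]]] [U' [p [q [V' [hU' hV' eW' Wg']]]]].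
  have [mp|/ltnW pm] := leqP m p.
    by apply: (main W W' U m n V p q U' V').
  have [W'' h s] := main W' W U' p q V' m n U V hU' hV' hU hV eW' eW Wg' Wg pm.
  by exists W'' => //; rewrite setIC.
move=> U m n V p q U' V' hU hV hU' hV' -> -> [Ug d Vg e] [Ug' d' Vg' e'] mp.
exists (cyl (U `&` U') m n (V `&` V')); last by apply: cylinderI => //; lia.
exists (U `&` U'), m, n, (V `&` V'); split=> //.
  by apply: injectivity_domainI => //; have [] := hU'.
by apply: injectivity_domainI => //; have [] := hV'.
Qed.

(** A basic open set is a finite intersection of cylinders, so by [cylinder_atI]
    the cylinders form a base and not only a subbase. *)
Lemma cylinder_base g (W : set G) : open W -> W g ->
  exists2 C, cylinder_at g C & C `<=` W.
Proof.
move=> [D sD <-] [B DB Bg]; have [F sF eB] := sD _ DB.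
suff [C hC CF] : exists2 C, cylinder_at g C &
    forall V, V \in enum_fset F -> C `<=` V.
  exists C => // h Ch; exists B => //=; rewrite -eB => V VF.
  exact: (CF V VF h Ch).
have {sF eB DB sD D B Bg} : forall V, V \in enum_fset F -> dr_subbase V /\ V g.
  move=> V VF; split; first by have := sF _ VF; rewrite inE.
  by move: Bg; rewrite -eB => /(_ V VF).
elim: (enum_fset F) => [_|V s IHs h].
  have [C hC _] := @cylinder_at_exists g setT setT openT I openT I.
  by exists C.
have [V' hV'|C hC CF] := IHs; first by apply: h; rewrite inE hV' orbT.
have [[U [m [n [U' [[oU Ud hU] [oU' Ud' hU'] eV]]]]] Vg] := h V (mem_head _ _).
have atV : cylinder_at g V.
  exists U, m, n, U'; split=> //.
    by split=> //; exact: homeo_set_inj.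
  by split=> //; exact: homeo_set_inj.
have [C' hC' C'I] := cylinder_atI hC atV; exists C' => // Z.
rewrite inE => /orP[/eqP -> x /C'I[]//|Zs x /C'I[Cx _]].
exact: CF Zs _ Cx.
Qed.

Lemma cylinder_at_open g C : cylinder_at g C -> open C /\ C g.
Proof. by move=> [U [m [n [V [hU hV -> Cg]]]]]; split=> //; exact: cylinder_open. Qed.

Lemma rng_continuous : continuous rng.
Proof.
apply/continuousP => O oO; apply: open_pointwise => g Og.
have [C /cylinder_at_open [oC Cg] CO] :=
  @cylinder_at_exists g O setT oO Og openT I.
by exists C; split=> // h /CO[].
Qed.

Lemma inv_open (W : set G) : open W -> open (dr_inv @^-1` W).
Proof.
move=> oW; apply: open_pointwise => g Wg.
have [_ [U [m [n [V [hU hV -> Cg]]]]] CW] := cylinder_base oW Wg.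
exists (cyl V n m U); split; [exact: cylinder_open|exact/inv_cylinder|].
by move=> h /inv_cylinder /CW.
Qed.

Lemma inv_continuous : continuous dr_inv.
Proof. by apply/continuousP => W; exact: inv_open. Qed.

Lemma src_continuous : continuous src.
Proof.
have -> : src = rng \o dr_inv by [].
by move=> g; apply: continuous_comp; [exact: inv_continuous|exact: rng_continuous].
Qed.

(** The image of [Z(U, m, n, V)] consists of the [x] in [U] with
    [iter_map m x] in the open set [iter_map n @` V]. *)
Lemma rng_open (W : set G) : open W -> open (rng @` W).
Proof.
move=> oW; apply: open_pointwise => _ [g Wg <-].
have [_ [U [m [n [V [hU hV -> [Ug d Vg e]]]]]] CW] := cylinder_base oW Wg.
have [oU Ud Ui] := hU; have [oV Vd Vi] := hV.
exists (U `&` (dom m `&` it m @^-1` (it n @` V))); split.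
- by apply: openI => //; apply: iter_preimage_open; exact: iter_image_open.
- by split=> //; split; [exact: Ud|exists (src g)].
- move=> x [Ux [dx [y Vy /esym exy]]].
  have [h [hr hd hs]] := arrow_exists dx (Vd _ Vy) exy.
  by exists h => //; apply: CW; split; rewrite ?hr ?hs.
Qed.

(** On an open bisection the open map [rng] is a homeomorphism onto its image,
    which reduces compactness in the groupoid to compactness in [X]. *)
Lemma compact_of_rng (W : set G) : open W -> set_inj W rng ->
  compact (rng @` W) -> compact W.
Proof.
move=> oW Wi kW F FF FW.
have [|_ [[w Ww <-] clw]] := kW (rng @ F) _.
  by rewrite /= nbhs_simpl; apply: filterS FW => g Wg; exists g.
exists w; split=> // B N FB nN.
have nNW : nbhs (rng w) (rng @` (N° `&` W)).
  apply: open_nbhs_nbhs; split; last first.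
    by exists w => //; split=> //; exact: nbhs_interior nN.
  by apply: rng_open; apply: openI => //; exact: open_interior.
have FBW : (rng @ F) (rng @` (B `&` W)).
  by rewrite /= nbhs_simpl; apply: filterS (filterI FB FW) => g Bg; exists g.
have [_ [[b [Bb Wb] <-] [n [Nn Wn] e]]] := clw _ _ FBW nNW.
have bn : b = n by apply: Wi; rewrite ?inE.
by exists b; split=> //; rewrite bn; exact: interior_subset.
Qed.

Definition prod_set (U V : set G) : set G :=
  [set g | exists u v, [/\ U u, V v & composes u v g]].

Lemma prod_set_inv U V :
  dr_inv @^-1` (prod_set (dr_inv @^-1` V) (dr_inv @^-1` U)) `<=` prod_set U V.
Proof.
move=> g [v [u [Vv Uu /composes_inv]]]; rewrite dr_invK => c.
by exists (dr_inv u), (dr_inv v).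
Qed.

(** Let [uv = g] with [u] in [Z(A, m, n, B)] and [v] in [Z(C, p, q, D)]. If
    [n <= p], an arrow of [Z(N, m + p - n, q, D)] with [N] small around [rng g]
    factors through any [y] in [B] and [C] with
    [iter_map n y = iter_map m (rng h)], and such a [y] exists because
    [iter_map n] is open. The case [p <= n] follows by inversion. *)
Lemma prod_set_open (U V : set G) : open U -> open V -> open (prod_set U V).
Proof.
move=> oU oV; apply: open_pointwise => g [u [v [Uu Vv c]]].
have [_ [A [m [n [B [hA hB -> Cu]]]]] CU] := cylinder_base oU Uu.
have [_ [C [p [q [D [hC hD -> Cv]]]]] CV] := cylinder_base oV Vv.
have main : forall U V u v g A m n B C p q D,
    injectivity_domain S m A -> injectivity_domain S n B ->
    injectivity_domain S p C -> injectivity_domain S q D ->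
    cyl A m n B u -> cyl A m n B `<=` U ->
    cyl C p q D v -> cyl C p q D `<=` V -> composes u v g -> (n <= p)%N ->
    exists O, [/\ open O, O g & O `<=` prod_set U V].
  move=> {}U {}V {}u {}v {}g {}A {}m {}n {}B {}C {}p {}q {}D
    {oU oV Uu Vv CU CV Cu Cv hA hB hC hD c}.
  move=> hA hB hC hD [Au du Bu eu] CU [Cv dv Dv ev] CV [euv r s d] np.
  have [[oA Ad _] [oB Bd _] [oC Cd _] [oD Dd _]] := And4 hA hB hC hD.
  pose t := (p - n)%N; have pE : p = (t + n)%N by rewrite subnK.
  have dtm : dom (t + m) (rng u).
    apply/iter_domD; split; first exact: Ad.
    rewrite eu euv; have /Cd := Cv; rewrite pE => /iter_domD[_]; exact.
  have Cu : C (src u) by rewrite euv.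
  pose O := A `&` (dom m `&` it m @^-1` (it n @` (B `&` C))).
  have oO : open O.
    apply: openI => //; apply: iter_preimage_open; apply: iter_image_open.
      exact: openI.
    by move=> x [/Bd].
  have Ou : O (rng u) by split=> //; split; [exact: Ad|exists (src u)].
  have [N [hN Nu NO]] := injectivity_domain_at dtm oO Ou.
  exists (cyl N (t + m) q D); split; first exact: cylinder_open.
    split; rewrite ?r ?s //; first by rewrite d du dv pE; lia.
    by rewrite iter_mapD eu euv -iter_mapD -pE.
  move=> h [Nh dh Dh eh]; have [Ah [dmh [y [By Cy] ey]]] := NO _ Nh.
  have [u' [ru du' su]] := arrow_exists (Ad _ Ah) (Bd _ By) (esym ey).
  have [|v' [rv dv' sv]] := @arrow_exists p q y (src h) (Cd _ Cy) (Dd _ Dh).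
    by rewrite pE iter_mapD ey -iter_mapD.
  exists u', v'; split.
  - by apply: CU; split; rewrite ?ru ?su.
  - apply: CV; split; rewrite ?rv ?sv //.
    by rewrite pE iter_mapD ey -iter_mapD.
  - by split; rewrite ?ru ?su ?rv ?sv// dh du' dv' pE; lia.
have [np|/ltnW pn] := leqP n p.
  exact: (main U V u v g A m n B C p q D).
have Cv' : cyl D q p C (dr_inv v) by apply/inv_cylinder.
have Cu' : cyl B n m A (dr_inv u) by apply/inv_cylinder.
have CV' : cyl D q p C `<=` dr_inv @^-1` V.
  by move=> h Ch; apply: CV; apply/inv_cylinder.
have CU' : cyl B n m A `<=` dr_inv @^-1` U.
  by move=> h Ch; apply: CU; apply/inv_cylinder.
have [N [oN Ng NP]] := main _ _ _ _ _ _ _ _ _ _ _ _ _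
  hD hC hB hA Cv' CV' Cu' CU' (composes_inv c) pn.
exists (dr_inv @^-1` N); split=> //; first exact: inv_open.
by apply: subset_trans (@prod_set_inv U V) => h; exact: NP.
Qed.

Lemma prod_set_rng_inj U V :
  set_inj U rng -> set_inj V rng -> set_inj (prod_set U V) rng.
Proof.
move=> Ui Vi g g'; rewrite !inE => -[u [v [Uu Vv c]]] [u' [v' [Uu' Vv' c']]] e.
have [[euv r s d] [euv' r' s' d']] := (c, c').
have uu : u = u' by apply: Ui; rewrite ?inE// -r -r'.
have vv : v = v' by apply: Vi; rewrite ?inE// -euv -euv' uu.
by move: c'; rewrite -uu -vv => c'; exact: composes_fun c c'.
Qed.

Lemma prod_set_src_inj U V :
  set_inj U src -> set_inj V src -> set_inj (prod_set U V) src.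
Proof.
move=> Ui Vi g g'; rewrite !inE => -[u [v [Uu Vv c]]] [u' [v' [Uu' Vv' c']]] e.
have [[euv r s d] [euv' r' s' d']] := (c, c').
have vv : v = v' by apply: Vi; rewrite ?inE// -s -s'.
have uu : u = u' by apply: Ui; rewrite ?inE// euv euv' vv.
by move: c'; rewrite -uu -vv => c'; exact: composes_fun c c'.
Qed.

(** Compactness is tested on ranges: the range of [UV] is the range of the
    arrows of [U] whose source lies in the compact, hence closed, range of
    [V]. *)
Lemma prod_set_bisection U V : compact_open_bisection U ->
  compact_open_bisection V -> compact_open_bisection (prod_set U V).
Proof.
move=> [kU oU rU sU] [kV oV rV sV].
have oP := prod_set_open oU oV; have rP := prod_set_rng_inj rU rV.
split=> //; last exact: prod_set_src_inj.
apply: compact_of_rng => //.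
have -> : rng @` prod_set U V = rng @` (U `&` src @^-1` (rng @` V)).
  apply/seteqP; split=> [_ [g [u [v [Uu Vv [e r s d]]]] <-]|].
    by exists u => //; split=> //; exists v.
  move=> _ [u [Uu [v Vv e]] <-]; have [g c] := composes_exists (esym e).
  by exists g; [exists u, v|have [] := c].
have cont (f : G -> X) A : continuous f -> compact A -> compact (f @` A).
  by move=> cf; apply: continuous_compact; exact: continuous_subspaceT.
apply: (cont); first exact: rng_continuous.
apply: compact_closedI => //; apply: preimage_closed.
  by move=> x _; exact: src_continuous.
apply: (compact_closed (dr_hausdorff S)).
by apply: (cont) => //; exact: rng_continuous.
Qed.

Lemma inv_bisection U :
  compact_open_bisection U -> compact_open_bisection (dr_inv @^-1` U).
Proof.
move=> [kU oU rU sU].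
have -> : dr_inv @^-1` U = dr_inv @` U.
  apply/seteqP; split=> [g Ug|_ [g Ug <-]]; last by rewrite /= dr_invK.
  by exists (dr_inv g) => //; rewrite dr_invK.
split.
- by apply: continuous_compact => //; apply: continuous_subspaceT; exact: inv_continuous.
- have := inv_open oU; congr open; apply/seteqP.
  split=> [g Ug|_ [g Ug <-]]; last by rewrite /= dr_invK.
  by exists (dr_inv g) => //; rewrite dr_invK.
- move=> _ _ /set_mem [g Ug <-] /set_mem [h Uh <-]; rewrite !rng_inv => e.
  by congr dr_inv; apply: sU; rewrite ?inE.
- move=> _ _ /set_mem [g Ug <-] /set_mem [h Uh <-]; rewrite !src_inv => e.
  by congr dr_inv; apply: rU; rewrite ?inE.
Qed.

Definition units (U : set X) : set G := unit_arrow @` U.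

Lemma units_bisection (U : set X) : compact U -> open U ->
  compact_open_bisection (units U).
Proof.
move=> kU oU.
have hU : injectivity_domain S 0 U by split=> // x y _ _.
have E : units U = cyl U 0 0 U.
  apply/seteqP; split=> [_ [x Ux <-]|g [Ug d Ug' e]]; first by split.
  by exists (rng g) => //; apply: arrow_ext => //; rewrite d.
have oE : open (units U) by rewrite E; exact: cylinder_open.
have rE : set_inj (units U) rng.
  by move=> g h; rewrite !inE => -[x _ <-] [y _ <-] /= e; congr unit_arrow.
split=> //; last first.
  by move=> g h; rewrite !inE => -[x _ <-] [y _ <-] /= e; congr unit_arrow.
apply: compact_of_rng => //; have -> // : rng @` units U = U.
apply/seteqP; split=> [_ [_ [x Ux <-] <-]//|x Ux].
by exists (unit_arrow x) => //; exists x.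
Qed.

End Groupoid.

(** * The Steinberg algebra *)

Section Algebra.
Variables (K : fieldType) (X : topologicalType) (S : dr_system X).
Local Notation G := (dr_groupoid S).
Local Notation rng := (@dr_rng X S).
Local Notation src := (@dr_src X S).
Local Notation deg := (@dr_deg X S).
Local Notation inv := (@dr_inv X S).
Local Notation A := (@steinberg K X S).
Local Notation conv := (@convolution K X S).
Implicit Types f a : G -> K.

Lemma steinberg0 : A (0 : G -> K).
Proof.
exists 0%N, (fun=> 0), (fun=> set0); split; first by case.
by apply/funext => g; rewrite big_ord0.
Qed.

Lemma steinberg_cons (c : K) U f : compact_open_bisection U -> A f ->
  A (fun g => c * \1_U g + f g).
Proof.
move=> hU [n [d [V [hV ->]]]].
exists n.+1, (fun i => if unlift ord0 i is Some j then d j else c),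
  (fun i => if unlift ord0 i is Some j then V j else U).
split=> [i|]; first by case: unliftP => [j|] _.
apply/funext => g; rewrite big_ord_recl unlift_none; congr +%R.
by apply: eq_bigr => i _; rewrite liftK.
Qed.

Lemma steinberg_ind (P : (G -> K) -> Prop) : P 0 ->
  (forall c U f, compact_open_bisection U -> A f -> P f ->
     P (fun g => c * \1_U g + f g)) ->
  forall f, A f -> P f.
Proof.
move=> P0 Pc f [n [c [U [hU ->]]]] {f}.
elim: n c U hU => [|n IHn] c U hU.
  suff -> : (fun g => \sum_(i < 0) c i * \1_(U i) g) = 0 :> (G -> K) by [].
  by apply/funext => g; rewrite big_ord0.
have -> : (fun g => \sum_(i < n.+1) c i * \1_(U i) g) = fun g =>
    c ord0 * \1_(U ord0) g + \sum_(i < n) c (lift ord0 i) * \1_(U (lift ord0 i)) g.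
  by apply/funext => g; rewrite big_ord_recl.
apply: Pc => //; last by apply: (IHn (c \o lift ord0) (U \o lift ord0)) => i /=.
by exists n, (c \o lift ord0), (U \o lift ord0); split=> // i /=.
Qed.

Lemma steinberg_indic (c : K) U : compact_open_bisection U ->
  A (fun g => c * \1_U g).
Proof.
move=> hU; have := steinberg_cons c hU steinberg0; congr (A _).
by apply/funext => g; rewrite addr0.
Qed.

Lemma steinberg_indicator U : compact_open_bisection U -> A \1_U.
Proof.
move=> /(steinberg_indic 1); congr (A _).
by apply/funext => g; rewrite mul1r.
Qed.

Lemma steinbergD f1 f2 : A f1 -> A f2 -> A (f1 + f2).
Proof.
move=> + h2; elim/steinberg_ind => [|c U f hU _ hf]; first by rewrite add0r.
have := steinberg_cons c hU hf; congr (A _).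
by apply/funext => g; rewrite !fctE addrA.
Qed.

Lemma steinbergN f : A f -> A (- f).
Proof.
elim/steinberg_ind => [|c U f' hU _ hf]; first by rewrite oppr0; exact: steinberg0.
have := steinberg_cons (- c) hU hf; congr (A _).
by apply/funext => g; rewrite !fctE opprD mulNr.
Qed.

Lemma steinbergB f1 f2 : A f1 -> A f2 -> A (f1 - f2).
Proof. by move=> h1 h2; apply: steinbergD => //; exact: steinbergN. Qed.

Lemma steinberg_inv f : A f -> A (f \o inv).
Proof.
elim/steinberg_ind => [|c U f' hU _ hf]; first exact: steinberg0.
have := steinberg_cons c (inv_bisection hU) hf; congr (A _).
Qed.

(** A bisection meets each fibre of [src] at most once. This finiteness is what
    makes the sums in convolutions, and in [class_sum_annihilator] below, behave
    additively. *)
Lemma src_fibre_finite f x : A f -> finite_set [set g | src g = x /\ f g != 0].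
Proof.
elim/steinberg_ind => [|c U f' [_ _ _ Ui] _ hf].
  by apply: sub_finite_set (finite_set0 G) => g [_] /=; rewrite eqxx.
have fU : finite_set (U `&` src @^-1` [set x]).
  have [[u [Uu <-]]|/nonemptyPn ->] := pselect (U `&` src @^-1` [set x] !=set0).
    apply: sub_finite_set (finite_set1 u) => g [Ug e].
    by apply: Ui; rewrite ?inE.
  exact: finite_set0.
have fUf : finite_set ((U `&` src @^-1` [set x]) `|`
    [set g | src g = x /\ f' g != 0]) by rewrite finite_setU.
apply: sub_finite_set fUf => g [e] fg.
have [Ug|nUg] := pselect (U g); [by left|right; split=> //].
by move: fg; rewrite indicE memNset// mulr0 add0r.
Qed.

Lemma rng_fibre_finite f x : A f -> finite_set [set g | rng g = x /\ f g != 0].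
Proof.
move=> /steinberg_inv /(src_fibre_finite x) /(finite_image inv).
apply: sub_finite_set => g [e fg]; exists (inv g); last exact: dr_invK.
by split=> //; rewrite /= dr_invK.
Qed.

Lemma convolutionE f1 f2 g :
  conv f1 f2 g = \sum_(p \in [set p : G * G | composes p.1 p.2 g]) f1 p.1 * f2 p.2.
Proof.
by apply: eq_fsbigl; apply/seteqP; split=> p /composesP.
Qed.

Lemma convolution_restrict f1 f2 g (E : set (G * G)) :
  (forall u v, composes u v g -> f1 u != 0 -> f2 v != 0 -> E (u, v)) ->
  conv f1 f2 g =
    \sum_(p \in [set p | composes p.1 p.2 g] `&` E) f1 p.1 * f2 p.2.
Proof.
move=> hE; rewrite convolutionE; apply/esym/fsbig_widen; first by move=> p [].
move=> [u v] [/= c nE]; apply/eqP; rewrite mulf_eq0.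
apply: contrapT => /negP; rewrite negb_or => /andP[hu hv].
by apply: nE; split=> //; exact: hE.
Qed.

(** Inversion of arrows is an anti-automorphism of the algebra; it exchanges
    left and right ideals. *)
Lemma convolution_inv f1 f2 :
  conv f1 f2 \o inv = conv (f2 \o inv) (f1 \o inv).
Proof.
apply/funext => g; rewrite /= !convolutionE.
rewrite (reindex_fsbig (fun p : G * G => (inv p.2, inv p.1))
  [set p | composes p.1 p.2 g]) /=.
  by apply: eq_fsbigr => p _; rewrite mulrC.
split=> [p /composes_inv //|[u v] [u' v'] _ _ e|].
  by move: (congr1 fst e) (congr1 snd e) => /= /dr_inv_inj -> /dr_inv_inj ->.
move=> [u v] /= /composes_inv; rewrite dr_invK => c.
by exists (inv v, inv u); rewrite //= !dr_invK.
Qed.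

(** Among the factorizations of [g], the one through [u] is the only one that
    starts in [U]: left multiplication by a bisection is a partial
    translation. *)
Lemma convolution_indicl U f u v g : set_inj U rng -> U u -> composes u v g ->
  conv \1_U f g = f v.
Proof.
move=> Ui Uu c; rewrite (@convolution_restrict _ _ _ [set (u, v)]).
  have -> : [set p | composes p.1 p.2 g] `&` [set (u, v)] = [set (u, v)].
    by apply/seteqP; split=> [p []//|p ->]; split.
  by rewrite fsbig_set1 /= indicE mem_set// mul1r.
move=> u' v' c' u'0 _; have [_ r _ _] := c; have [_ r' _ _] := c'.
have Uu' : U u'.
  by apply: contrapT => nU; move: u'0; rewrite indicE memNset// eqxx.
have uu : u' = u by apply: Ui; rewrite ?inE// -r -r'.
by move: c'; rewrite uu => /(composes_injr c) ->.
Qed.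

Lemma convolution_indicl0 U f g : (forall u, U u -> rng u <> rng g) ->
  conv \1_U f g = 0.
Proof.
move=> nU; rewrite convolutionE fsbig1// => -[u v] [/= _ r _ _].
by rewrite indicE memNset ?mul0r// => /nU; apply.
Qed.

Lemma convolution_indicr U f u v g : set_inj U src -> U v -> composes u v g ->
  conv f \1_U g = f u.
Proof.
move=> Ui Uv c.
have -> : conv f \1_U g = (conv f \1_U \o inv) (inv g) by rewrite /= dr_invK.
have := @convolution_indicl (inv @^-1` U) (f \o inv) (inv v) (inv u) (inv g).
rewrite convolution_inv => h; rewrite -[f u]/((f \o id) u).
transitivity ((f \o inv) (inv u)); last by rewrite /= dr_invK.
rewrite -h //; last 2 first.
- by rewrite /= dr_invK.
- exact: composes_inv.
- move=> g1 g2; rewrite !inE => U1 U2 e.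
  by apply: dr_inv_inj; apply: Ui; rewrite ?inE.
Qed.

Lemma convolution_indic U V : set_inj U rng ->
  conv \1_U \1_V = \1_(prod_set U V).
Proof.
move=> Ui; apply/funext => g.
have [[u [Uu r]]|nU] := pselect (exists u, U u /\ rng u = rng g); last first.
  rewrite convolution_indicl0; last by move=> u Uu r; apply: nU; exists u.
  rewrite indicE memNset// => -[u [v [Uu Vv [_ r _ _]]]].
  by apply: nU; exists u.
have [v c] := composes_divl (esym r).
rewrite (convolution_indicl _ Ui Uu c) !indicE; congr (_%:R); congr nat_of_bool.
apply/idP/idP; rewrite !inE; first by exists u, v.
move=> [u' [v' [Uu' Vv' c']]].
have [_ r' _ _] := c'.
have uu : u' = u by apply: Ui; rewrite ?inE// r -r'.
by move: c'; rewrite uu => /(composes_injr c) ->.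
Qed.

Lemma convolutionDr a f1 f2 : A a -> A f1 -> A f2 ->
  conv a (f1 + f2) = conv a f1 + conv a f2.
Proof.
move=> ha h1 h2; apply/funext => g; rewrite [RHS]/=.
pose E := [set u | rng u = rng g /\ a u != 0] `*`
  ([set v | src v = src g /\ f1 v != 0] `|` [set v | src v = src g /\ f2 v != 0]).
have fE : finite_set ([set p : G * G | composes p.1 p.2 g] `&` E).
  apply: finite_setIr; apply: finite_setX; first exact: rng_fibre_finite.
  by rewrite finite_setU; split; exact: src_fibre_finite.
rewrite !fctE !(@convolution_restrict _ _ g E).
- by rewrite -fsbig_split//; apply: eq_fsbigr => p _; rewrite mulrDr.
- by move=> u v [_ r s _] au fv; split=> //; right.
- by move=> u v [_ r s _] au fv; split=> //; left.
- move=> u v [_ r s _] au fv; split=> //=.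
  have [f1v|] := eqVneq (f1 v) 0; last by left.
  by right; split=> //; move: fv; rewrite f1v add0r.
Qed.

Lemma inv_compK f : (f \o inv) \o inv = f.
Proof. by apply/funext => g /=; rewrite dr_invK. Qed.

Lemma convolutionDl f1 f2 a : A a -> A f1 -> A f2 ->
  conv (f1 + f2) a = conv f1 a + conv f2 a.
Proof.
move=> ha h1 h2; rewrite -[LHS]inv_compK convolution_inv.
have -> : (f1 + f2) \o inv = (f1 \o inv) + (f2 \o inv) by [].
rewrite convolutionDr; [|exact: steinberg_inv..].
by rewrite -!convolution_inv; apply/funext => g; rewrite !fctE /= dr_invK.
Qed.

Lemma convolutionZl (c : K) f1 f2 :
  conv (fun g => c * f1 g) f2 = fun g => c * conv f1 f2 g.
Proof.
apply/funext => g; rewrite mulr_fsumr.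
by apply: eq_fsbigr => p _; rewrite mulrA.
Qed.

Lemma convolutionZr (c : K) f1 f2 :
  conv f1 (fun g => c * f2 g) = fun g => c * conv f1 f2 g.
Proof.
apply/funext => g; rewrite mulr_fsumr.
by apply: eq_fsbigr => p _; rewrite mulrCA.
Qed.

Lemma convolution0r a : conv a 0 = 0.
Proof. by apply/funext => g; apply: fsbig1 => p _; rewrite mulr0. Qed.

Lemma convolution0l a : conv 0 a = 0.
Proof. by apply/funext => g; apply: fsbig1 => p _; rewrite mul0r. Qed.

Lemma convolution_consl (c : K) U f a : compact_open_bisection U -> A f -> A a ->
  conv (fun g => c * \1_U g + f g) a = fun g => c * conv \1_U a g + conv f a g.
Proof.
move=> hU hf ha.
have -> : (fun g => c * \1_U g + f g) = (fun g => c * \1_U g) + f :> (G -> K) by [].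
rewrite convolutionDl//; last exact: steinberg_indic.
by rewrite convolutionZl.
Qed.

Lemma steinberg_convolution f1 f2 : A f1 -> A f2 -> A (conv f1 f2).
Proof.
move=> + h2; elim/steinberg_ind => [|c U f hU hf IHf].
  by rewrite convolution0l; exact: steinberg0.
rewrite convolution_consl//.
suff hUf : A (fun g => c * conv \1_U f2 g) by exact: (steinbergD hUf IHf).
move: h2; elim/steinberg_ind => [|d V f' hV hf' IHf'].
  rewrite convolution0r; have := steinberg_indic 0 hU; congr (A _).
  by apply/funext => g; rewrite mul0r mulr0.
have := steinberg_cons (c * d) (prod_set_bisection hU hV) IHf'.
congr (A _); apply/funext => g.
have -> : (fun g => d * \1_V g + f' g) =
  (fun g => d * \1_V g) + f' :> (G -> K) by [].
rewrite convolutionDr//; [|exact: steinberg_indicator|exact: steinberg_indic].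
rewrite convolutionZr fctE mulrDr mulrA convolution_indic//.
by have [] := hU.
Qed.

End Algebra.

(** * Chain conditions in non-unital rings *)

Section NonUnitalRings.
Variables (V : zmodType) (mul : V -> V -> V) (A : set V).
Local Notation left_ideal := (left_ideal mul A).
Local Notation right_ideal := (right_ideal mul A).

Lemma left_idealI I J : left_ideal I -> left_ideal J -> left_ideal (I `&` J).
Proof.
move=> [[IA I0 IB] IM] [[JA J0 JB] JM]; split=> [|a x Aa [Ix Jx]].
  split=> // [x [/IA]//|x y [Ix Jx] [Iy Jy]].
  by split; [exact: IB|exact: JB].
by split; [exact: IM|exact: JM].
Qed.

Lemma left_idealD I x y : left_ideal I -> I x -> I y -> I (x + y).
Proof.
move=> [[_ I0 IB] _] Ix Iy; rewrite -[y]opprK -[- y]sub0r.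
by apply: (IB) => //; exact: IB.
Qed.

Lemma decreasing_chain (I : nat -> set V) m n :
  (forall n, I n.+1 `<=` I n) -> (m <= n)%N -> I n `<=` I m.
Proof.
move=> dI /subnK <-; elim: (n - m)%N => //= k IHk.
by apply: subset_trans IHk; exact: dI.
Qed.

(** The condition is relative to [N] so that it can be proved by adding one simple
    summand at a time. *)
Definition dcc_below (N : set V) := forall I : nat -> set V,
  (forall n, left_ideal (I n)) -> (forall n, I n.+1 `<=` I n) ->
  (forall n, I n `<=` N) -> exists k, forall n, (k <= n)%N -> I n = I k.

Definition sum_set (N M : set V) : set V :=
  [set x | exists n m, [/\ N n, M m & x = n + m]].

Hypothesis A_sub : forall x y, A x -> A y -> A (x - y).
Hypothesis mulDr : forall a x y, A a -> A x -> A y ->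
  mul a (x + y) = mul a x + mul a y.

Lemma sum_set_left_ideal N M :
  left_ideal N -> left_ideal M -> left_ideal (sum_set N M).
Proof.
move=> hN hM; have [[NA N0 NB] NM] := hN; have [[MA M0 MB] MM] := hM.
have A0 := NA _ N0.
split; first split.
- move=> _ [n [m [/NA An /MA Am ->]]].
  by rewrite -[m]opprK; apply: A_sub => //; rewrite -sub0r; exact: A_sub.
- by exists 0, 0; rewrite addr0.
- move=> _ _ [n [m [Nn Mm ->]]] [n' [m' [Nn' Mm' ->]]].
  exists (n - n'), (m - m'); split; [exact: NB|exact: MB|].
  by rewrite opprD addrACA.
- move=> a _ Aa [n [m [Nn Mm ->]]]; exists (mul a n), (mul a m).
  by split; [exact: NM|exact: MM|rewrite mulDr//; [exact: NA|exact: MA]].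
Qed.

(** Extending by a simple module preserves the chain condition: along a chain
    [I], the intersections of the [I n] with [N] stabilise, and so do those of
    the [N + I n] with [M], each of which is [0] or [M]. By the modular law
    the chain is constant from there on. *)
Lemma dcc_below_sum N M : left_ideal N -> dcc_below N ->
  simple_left_ideal mul A M -> dcc_below (sum_set N M).
Proof.
move=> hN dN [hM M_neq0 Ms] I hI dI INM.
have [[NA N0 NB] NM] := hN; have [[MA M0 MB] MM] := hM.
have [k kP] : exists k, forall n, (k <= n)%N -> I n `&` N = I k `&` N.
  apply: (dN (fun n => I n `&` N)) => [n|n x [/dI ? ?]|n x []//].
    exact: left_idealI.
  by [].
pose Q n := [set m | M m /\ exists2 x, N x & I n (x + m)].
have hQ n : left_ideal (Q n).
  have [[IA I0 IB] IM] := hI n; split; first split.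
  - by move=> m [/MA].
  - by split=> //; exists 0; rewrite ?addr0.
  - move=> m m' [Mm [x Nx Ix]] [Mm' [x' Nx' Ix']]; split; first exact: MB.
    by exists (x - x'); [exact: NB|rewrite addrACA -opprD; exact: IB].
  - move=> a m Aa [Mm [x Nx Ix]]; split; first exact: MM.
    exists (mul a x); first exact: NM.
    by rewrite -mulDr//; [exact: IM|exact: NA|exact: MA].
have dQ n : Q n.+1 `<=` Q n.
  by move=> m [Mm [x Nx Ix]]; split=> //; exists x => //; exact: dI.
(* once some Q n is 0 all later ones are; otherwise they all equal M *)
have [l lP] : exists l, forall n, (l <= n)%N -> Q l `<=` Q n.
  have [[l Ql]|nQ] := pselect (exists l, Q l = [set 0]).
    exists l => n _; rewrite Ql => _ ->.
    by have [[]] := hQ n.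
  exists 0%N => n _; have [|Qn|->] := Ms _ (hQ n); first by move=> m [].
    by case: nQ; exists n.
  by move=> m [].
exists (maxn k l) => n; rewrite geq_max => /andP[kn ln].
apply/seteqP; split.
  by apply: decreasing_chain => //; rewrite geq_max kn.
move=> x Ix; have [y [m [Ny Mm xE]]] := INM _ _ Ix.
have [|_ [y' Ny' Iy']] := lP n ln m.
  split=> //; exists y => //; rewrite -xE.
  by apply: (decreasing_chain dI _ Ix); exact: leq_maxr.
have Ikx : I k x by apply: (decreasing_chain dI _ Ix); exact: leq_maxl.
have : (I k `&` N) (x - (y' + m)).
  split; last by rewrite xE opprD addrACA subrr addr0; exact: NB.
  have [[_ _ IB] _] := hI k; apply: IB => //.
  exact: (decreasing_chain dI kn).
rewrite -(kP n kn) => -[In _].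
by rewrite -[x](subrK (y' + m)); exact: left_idealD (hI n) In Iy'.
Qed.

Lemma dcc_below_finite_sum (J : choiceType) (M : J -> set V) (s : seq J) :
  A 0 -> (forall a, A a -> mul a 0 = 0) ->
  (forall j, simple_left_ideal mul A (M j)) ->
  exists N, [/\ left_ideal N, dcc_below N &
    forall x : J -> V, (forall j, M j (x j)) -> N (\sum_(j <- s) x j)].
Proof.
move=> A0 mul0 Ms; elim: s => [|j s [N [hN dN NM]]].
  exists [set 0]; split.
  - split; first by split=> // [_ ->//|_ _ -> ->]; rewrite /= subrr.
    by move=> a _ Aa ->; rewrite /= mul0.
  - move=> I hI dI I0; exists 0%N => n _.
    have E k : I k = [set 0].
      by apply/seteqP; split=> // _ ->; have [[]] := hI k.
    by rewrite !E.
  - by move=> x _; rewrite big_nil.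
exists (sum_set N (M j)); split.
- by apply: sum_set_left_ideal => //; have [] := Ms j.
- exact: dcc_below_sum.
- move=> x Mx; rewrite big_cons addrC.
  by exists (\sum_(i <- s) x i), (x j); split=> //; exact: NM.
Qed.

(** The unit lies in the sum of finitely many of the simple summands, hence
    so does everything else. *)
Lemma semisimple_left_artinian : semisimple mul A -> left_artinian mul A.
Proof.
move=> [[e Ae eA] [J [M [Ms decA]]]].
have A0 : A 0 by rewrite -(subrr e); exact: A_sub.
have mul0 a : A a -> mul a 0 = 0.
  by move=> Aa; apply: (@addrI _ (mul a 0)); rewrite -mulDr// !addr0.
have [x [[Mx fx ex] _]] := decA _ Ae.
have [N [hN dN NM]] := dcc_below_finite_sum (fset_set [set j | x j != 0]) A0 mul0 Ms.
have Ne : N e.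
  rewrite ex (fsbig_supp _ [set: J]) setTI.
  have -> : x @^-1` [set~ 0] = [set j | x j != 0].
    by apply/seteqP; split=> j /= /eqP.
  by rewrite fsbig_finite//; exact: NM.
move=> I hI dI; apply: dN => // n a Ia.
have [[IA _ _] _] := hI n; have Aa := IA _ Ia.
by rewrite -(eA _ Aa).2; have [_] := hN; apply.
Qed.

Section AntiInvolution.
Variable phi : V -> V.
Hypotheses (phiK : involutive phi) (phiB : forall x y, phi (x - y) = phi x - phi y).
Hypothesis phiM : forall a b, phi (mul a b) = mul (phi b) (phi a).
Hypothesis phiA : forall a, A a -> A (phi a).

Lemma phi0 : phi 0 = 0. Proof. by have := phiB 0 0; rewrite !subrr. Qed.

Lemma anti_subgroup I : additive_subgroup A I -> additive_subgroup A (phi @^-1` I).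
Proof.
move=> [IA I0 IB]; split=> [x /IA /phiA|/=|x y Ix Iy /=].
- by rewrite phiK.
- by rewrite phi0.
- by rewrite phiB; exact: IB.
Qed.

Lemma anti_left_right I : left_ideal I -> right_ideal (phi @^-1` I).
Proof.
move=> [/anti_subgroup hI IM]; split=> // a x Aa Ix /=.
by rewrite phiM; apply: IM => //; exact: phiA.
Qed.

Lemma anti_right_left I : right_ideal I -> left_ideal (phi @^-1` I).
Proof.
move=> [/anti_subgroup hI IM]; split=> // a x Aa Ix /=.
by rewrite phiM; apply: IM => //; exact: phiA.
Qed.

Lemma anti_dcc (P P' : set V -> Prop) : (forall I, P' I -> P (phi @^-1` I)) ->
  descending_chain_condition P -> descending_chain_condition P'.
Proof.
move=> PP' dP I hI dI.
have [N NP] := dP (fun n => phi @^-1` I n) (fun n => PP' _ (hI n))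
  (fun n x => dI n (phi x)).
have phiKK J : phi @^-1` (phi @^-1` J) = J.
  by apply/funext => x; rewrite /preimage /= phiK.
by exists N => n /NP /(congr1 (preimage phi)); rewrite !phiKK.
Qed.

Lemma left_right_artinian : left_artinian mul A <-> right_artinian mul A.
Proof.
by split; apply: anti_dcc; [exact: anti_right_left|exact: anti_left_right].
Qed.

End AntiInvolution.
End NonUnitalRings.

(** * Finite groupoids and loops *)

Section FiniteGroupoid.
Variables (X : topologicalType) (S : dr_system X).
Local Notation G := (dr_groupoid S).
Local Notation rng := (@dr_rng X S).
Local Notation src := (@dr_src X S).
Local Notation deg := (@dr_deg X S).
Local Notation dom := (iter_dom S).
Local Notation it := (iter_map S).

Lemma iter_dom_le m n : (m <= n)%N -> dom n `<=` dom m.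
Proof. by move=> /subnK <- x /iter_domD[]. Qed.

Lemma finite_groupoid N : finite_set [set: X] -> dom N = set0 ->
  finite_set [set: G].
Proof.
move=> fX dN.
have small m x : dom m x -> (m < N)%N.
  move=> dx; rewrite ltnNge; apply/negP => Nm.
  by have : set0 x by rewrite -dN; exact: iter_dom_le dx.
pose T : set (X * int * X) :=
  (setT `*` [set m%:Z - n%:Z | m in `I_N & n in `I_N]) `*` setT.
have fT : finite_set T.
  apply: finite_setX => //; apply: finite_setX => //.
  by apply: finite_image2; exact: finite_II.
have -> : [set: G] = @dr_arrow X S @^-1` T.
  apply/seteqP; split=> // g _; have [m [n [d dm dn _]]] := arrow_witness g.
  split=> //; split=> //; exists m => /=; first exact: small dm.
  by exists n => //; exact: small dn.
by apply: finite_preimage => // g h _ _; exact: val_inj.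
Qed.

Lemma finite_units : finite_set [set: G] -> finite_set [set: X].
Proof.
move=> fG; rewrite -(preimage_setT (@unit_arrow X S)).
by apply: finite_preimage => // x y _ _ /(congr1 rng).
Qed.

Lemma isotropy_power (g : G) k : rng g = src g ->
  exists h : G, [/\ rng h = rng g, src h = rng g & deg h = deg g *+ k].
Proof.
move=> rs; elim: k => [|k [h [r s d]]]; first by exists (unit_arrow S (rng g)).
have [h' [_ r' s' d']] := composes_exists s.
by exists h'; split; rewrite ?r' ?s' ?d' ?d ?mulrSr.
Qed.

(** An isotropy arrow of nonzero degree has infinitely many powers, which are
    distinguished by their degrees. *)
Lemma finite_groupoid_principal (g : G) : finite_set [set: G] ->
  rng g = src g -> deg g = 0.
Proof.
move=> fG rs; apply/eqP; apply: contrapT => /negP d0.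
have [p pP] := choice (fun k => isotropy_power k rs).
suff : finite_set (p @^-1` setT) by rewrite preimage_setT; exact: infinite_nat.
apply: finite_preimage => // i j _ _ pij.
have [_ _ di] := pP i; have [_ _ dj] := pP j.
by apply: (mulrIn d0); rewrite -di -dj pij.
Qed.

Lemma principal_ext (g h : G) : finite_set [set: G] ->
  rng g = rng h -> src g = src h -> g = h.
Proof.
move=> fG r s; apply: arrow_ext => //.
have [u [e ru su d]] := composes_divr s.
have := @finite_groupoid_principal u fG; rewrite -ru e r => /(_ erefl) du.
by rewrite d du add0r.
Qed.

Lemma finite_discrete : finite_set [set: X] -> forall U : set X, open U.
Proof.
move=> fX U; rewrite -[U]setCK; apply: closed_openC.
have /accessible_finite_set_closed := hausdorff_accessible (dr_hausdorff S).
by apply; apply: sub_finite_set fX.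
Qed.

Lemma singleton_bisection (g : G) : finite_set [set: X] ->
  compact_open_bisection [set g].
Proof.
move=> /finite_discrete oX; split.
- exact: compact_set1.
- have [C atC CE] := @cylinder_at_exists X S g [set rng g] [set src g]
    (oX _) erefl (oX _) erefl.
  have [oC Cg] := cylinder_at_open atC.
  suff -> : [set g] = C by [].
  apply/seteqP; split=> [_ ->//|h Ch]; have [r s] := CE _ Ch.
  apply: arrow_ext => //; move: atC => [U [m [n [V [_ _ eC _]]]]].
  by move: Cg Ch; rewrite eC => -[_ -> _ _] [_ -> _ _].
- by move=> x y; rewrite !inE => -> ->.
- by move=> x y; rewrite !inE => -> ->.
Qed.

(** The first [N + 1] points of the orbit of a point of [iter_dom S N] cannot be
    distinct, and the resulting cycle is a loop of positive degree. *)
Lemma periodic_point N : finite_set [set: X] -> N = #|` fset_set [set: X]| ->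
  dom N !=set0 -> exists g : G, rng g = src g /\ 0 < deg g.
Proof.
move=> fX eN [x dx].
have : ~~ uniq [seq it i x | i <- iota 0 N.+1].
  apply/negP => u.
  have /(uniq_leq_size u) : {subset [seq it i x | i <- iota 0 N.+1]
      <= fset_set [set: X]} by move=> z _; rewrite in_fset_set// inE.
  by rewrite size_map size_iota -eN ltnn.
move=> /(uniqPn x)[i [j []]]; rewrite size_map size_iota => ij jN.
rewrite !(nth_map 0%N) ?size_iota//; last exact: ltn_trans ij jN.
rewrite !nth_iota//; last exact: ltn_trans ij jN.
rewrite !add0n => e.
have dj : dom ((j - i) + i)%N x by rewrite subnK ?(ltnW ij)//; exact: iter_dom_le dx.
have [dxi dji] := (iter_domD S (j - i) i x).1 dj.
have [|g [r d s]] := @arrow_exists X S (j - i) 0 (it i x) (it i x) dji I.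
  by rewrite -iter_mapD subnK ?(ltnW ij).
by exists g; split; [rewrite r s|rewrite d; lia].
Qed.

End FiniteGroupoid.

(** * Finitely supported sums *)

Section FiniteSums.
Variables (K : fieldType) (T : choiceType).

Lemma fsum_linear (C : set T) (c : K) (f1 f2 : T -> K) :
  finite_set (C `&` [set h | f1 h != 0]) -> finite_set (C `&` [set h | f2 h != 0]) ->
  \sum_(h \in C) (c * f1 h + f2 h) =
  c * (\sum_(h \in C) f1 h) + \sum_(h \in C) f2 h.
Proof.
move=> F1 F2; pose E := (C `&` [set h | f1 h != 0]) `|` (C `&` [set h | f2 h != 0]).
have fE : finite_set E by rewrite finite_setU.
have EC : E `<=` C by move=> h [[]|[]].
have out h : (C `\` E) h -> f1 h = 0 /\ f2 h = 0.
  move=> [Ch nE]; split; apply/eqP; apply: contrapT => /negP fh; apply: nE.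
    by left.
  by right.
have restrict (f : T -> K) : (forall h, (C `\` E) h -> f h = 0) ->
    \sum_(h \in C) f h = \sum_(h \in E) f h.
  by move=> f0; apply/esym/(fsbig_widen E C) => // h /f0.
rewrite !restrict; first by rewrite fsbig_split// mulr_fsumr.
- by move=> h /out[-> ->]; rewrite mulr0 addr0.
- by move=> h /out[].
- by move=> h /out[].
Qed.

Lemma fsum_setU (B C : set T) (f : T -> K) :
  finite_set ((B `|` C) `&` [set h | f h != 0]) -> B `&` C `<=` set0 ->
  \sum_(h \in B `|` C) f h = \sum_(h \in B) f h + \sum_(h \in C) f h.
Proof.
have E D : \sum_(h \in D) f h = \sum_(h \in D `&` [set h | f h != 0]) f h.
  rewrite fsbig_supp; apply: eq_fsbigl; apply/seteqP.
  by split=> h [Dh /eqP fh].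
rewrite (E (_ `|` _)) (E B) (E C) setIUl finite_setU => -[fB fC] BC.
by apply: fsbigU0 => // h [[Bh _] [Ch _]]; apply: BC.
Qed.

Lemma fsum_indic1 (C : set T) (e : T) :
  \sum_(h \in C) (\1_[set e] h : K) = (e \in C)%:R.
Proof.
have [eC|eC] := boolP (e \in C).
  have : [set e] `<=` C by move=> _ ->; exact: set_mem.
  move=> eC'; transitivity (\sum_(h \in [set e]) (\1_[set e] h : K)).
    apply/esym/fsbig_widen => // h [_ he] /=.
    by rewrite indicE memNset.
  by rewrite fsbig_set1 indicE mem_set.
rewrite fsbig1// => h Ch; rewrite indicE memNset// => he.
by move: eC; rewrite -he mem_set.
Qed.

End FiniteSums.

(** * Left ideals of an Artinian Steinberg algebra *)

Section ArtinianImpliesFinite.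
Variables (K : fieldType) (X : topologicalType) (S : dr_system X).
Local Notation G := (dr_groupoid S).
Local Notation rng := (@dr_rng X S).
Local Notation src := (@dr_src X S).
Local Notation deg := (@dr_deg X S).
Local Notation A := (@steinberg K X S).
Local Notation conv := (@convolution K X S).

(** Left multiplication does not change sources, so vanishing over a set of
    sources defines a left ideal. *)
Definition fibre_annihilator (E : set X) : set (G -> K) :=
  [set f | A f /\ forall g, E (src g) -> f g = 0].

Lemma fibre_annihilator_left_ideal E : left_ideal conv A (fibre_annihilator E).
Proof.
split; first split.
- by move=> f [].
- by split=> //; exact: steinberg0.
- move=> f1 f2 [h1 z1] [h2 z2]; split; first exact: steinbergB.
  by move=> g Eg; rewrite !fctE z1// z2// subrr.
- move=> a f ha [hf zf]; split; first exact: steinberg_convolution.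
  move=> g Eg; rewrite convolutionE fsbig1// => -[u v] [/= _ _ s _].
  by rewrite zf ?mulr0// -s.
Qed.

(** For distinct points [x 0, x 1, ...] the ideals of functions vanishing over
    [x 0, ..., x (n - 1)] decrease strictly: a compact open neighbourhood of
    [x n] that avoids the earlier points separates consecutive ideals. *)
Lemma left_artinian_finite : totally_disconnected [set: X] ->
  left_artinian conv A -> finite_set [set: X].
Proof.
move=> tdX art; apply: contrapT => /infiniteP/card_leP[e].
pose x (n : nat) : X := val (e (SigSub (mem_setT n))).
have x_inj : injective x.
  move=> i j /val_inj eij; have : SigSub (mem_setT i) = SigSub (mem_setT j).
    by apply: (@inj _ _ _ e); rewrite ?inE.
  by move=> /(congr1 val).
have [|N NP] := art (fun n => fibre_annihilator (x @` `I_n))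
    (fun n => fibre_annihilator_left_ideal _).
  move=> n f [hf zf]; split=> // g [i /= iN xi]; apply: zf.
  by exists i => //=; exact: ltnW.
have oO : open (~` (x @` `I_N)).
  apply: closed_openC.
  have /accessible_finite_set_closed := hausdorff_accessible (dr_hausdorff S).
  by apply; apply: finite_image; exact: finite_II.
have [|E [kE oE Ex EO]] :=
    compact_open_nbhs (dr_hausdorff S) (dr_locally_compact S) tdX oO (x := x N).
  by move=> [i /[swap] /x_inj -> /=]; rewrite ltnn.
have hU := units_bisection S kE oE.
have : fibre_annihilator (x @` `I_N) (fun g => 1 * \1_(units (S := S) E) g).
  split; first exact: steinberg_indic.
  move=> g xg; rewrite indicE memNset ?mulr0// => -[y /EO nxy gy].
  by apply: nxy; move: xg; rewrite -gy.
rewrite -(NP N.+1 (leqnSn N)) => -[_ /(_ (unit_arrow S (x N)))].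
rewrite indicE mem_set; last by exists (x N).
rewrite mulr1 => h; have /eqP := h (ex_intro2 _ _ N (ltnSn N) erefl).
by rewrite oner_eq0.
Qed.

Definition degree_class (y : X) (q : int) (x : X) (c : int) : set G :=
  [set h | [/\ rng h = x, src h = y & (q %| deg h - c)%Z]].

(** On the isotropy group of [y] this is the kernel of the map from the group
    algebra to that of the quotient by the loops of degree divisible by [q]; the
    other ranges [x] extend this kernel to a left ideal. *)
Definition class_sum_annihilator y q : set (G -> K) :=
  [set f | A f /\ forall x c, \sum_(h \in degree_class y q x c) f h = 0].

Lemma degree_class_finite f y q x c : A f ->
  finite_set (degree_class y q x c `&` [set h | f h != 0]).
Proof.
by move=> /(src_fibre_finite y); apply: sub_finite_set => h [[_ s _] fh].
Qed.

(** Left translation by [u] is a bijection between degree classes, shifting the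
    residue by [deg u]. *)
Lemma class_sum_translate y q u x c (f : G -> K) (U : set G) :
  set_inj U rng -> U u -> rng u = x ->
  \sum_(h \in degree_class y q x c) conv \1_U f h =
  \sum_(v \in degree_class y q (src u) (c - deg u)) f v.
Proof.
move=> Ui Uu ux.
have mulE v : exists g, src u = rng v -> composes u v g.
  have [/composes_exists [g c']|nuv] := pselect (src u = rng v); first by exists g.
  by exists u => /nuv.
have {mulE} [F FP] := choice mulE.
rewrite (reindex_fsbig F (degree_class y q (src u) (c - deg u))).
  apply: eq_fsbigr => v; rewrite inE => -[r _ _].
  by apply: convolution_indicl Uu _ => //; exact: FP.
split.
- move=> v [r s d]; have [_ r' s' d'] := FP v (esym r).
  split; rewrite ?r' ?s'// d'.
  by have -> : deg u + deg v - c = deg v - (c - deg u) by ring.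
- move=> v v'; rewrite !inE => -[r _ _] [r' _ _] e.
  have c1 := FP v (esym r); have c2 := FP v' (esym r').
  by apply: composes_injr c1 _; rewrite e.
- move=> g [r s d]; have [v cv] := composes_divl (etrans r (esym ux)).
  have [e r' s' d'] := cv.
  exists v; last by apply: composes_fun (FP v e) cv.
  split=> //; first by rewrite -s' s.
  have -> // : deg v - (c - deg u) = deg g - c by rewrite d'; ring.
Qed.

Lemma class_sum_annihilator_left_ideal y q :
  left_ideal conv A (class_sum_annihilator y q).
Proof.
split; first split.
- by move=> f [].
- split; first exact: steinberg0.
  by move=> x c; apply: fsbig1.
- move=> f1 f2 [h1 z1] [h2 z2]; split; first exact: steinbergB.
  move=> x c; transitivity (\sum_(h \in degree_class y q x c) (-1 * f2 h + f1 h)).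
    by apply: eq_fsbigr => h _; rewrite !fctE mulN1r addrC.
  by rewrite fsum_linear ?z1 ?z2 ?mulr0 ?addr0//; exact: degree_class_finite.
move=> a f ha [hf zf]; split; first exact: steinberg_convolution.
elim/steinberg_ind: ha => [x c|d U a' hU ha' IHa x c].
  by rewrite convolution0l; apply: fsbig1.
rewrite convolution_consl// fsum_linear; last 2 first.
- apply: degree_class_finite; apply: steinberg_convolution => //.
  exact: steinberg_indicator.
- by apply: degree_class_finite; exact: steinberg_convolution.
rewrite IHa addr0; have [_ _ Ui _] := hU.
have [[u [Uu ux]]|nU] := pselect (exists u, U u /\ rng u = x).
  by rewrite (class_sum_translate _ _ _ _ Ui Uu ux) zf mulr0.
rewrite fsbig1 ?mulr0// => h [r _ _].
by apply: convolution_indicl0 => u Uu e; apply: nU; exists u; rewrite e.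
Qed.

Lemma degree_class_double y q x c :
  degree_class y q x c =
  degree_class y (q + q) x c `|` degree_class y (q + q) x (c + q).
Proof.
apply/seteqP; split=> h.
  move=> [r s /dvdzP[k dk]].
  have [j [kj|kj]] : exists j, k = j + j \/ k = j + j + 1.
    exists (k %/ 2)%Z; have := divz_eq k 2; have := ltz_pmod k (isT : 0 < 2 :> int).
    by have := @modz_ge0 k 2 isT; lia.
  - by left; split=> //; apply/dvdzP; exists j; rewrite dk kj; ring.
  - right; split=> //; apply/dvdzP; exists j.
    by rewrite opprD addrA dk kj; ring.
move=> [|] [r s /dvdzP[k dk]]; split=> //; apply/dvdzP.
  by exists (k + k); rewrite dk; ring.
exists (k + k + 1).
have -> : deg h - c = (deg h - (c + q)) + q by ring.
by rewrite dk; ring.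
Qed.

Lemma dvdz_double (q : int) : 0 < q -> ~ (q + q %| q)%Z.
Proof.
move=> q0 /dvdzP[k /eqP]; rewrite -subr_eq0.
have -> : q - k * (q + q) = q * (1 - (k + k)) by ring.
by rewrite mulf_eq0 gt_eqF//= => /eqP; lia.
Qed.

Lemma class_sum_annihilator_double y q : 0 < q ->
  class_sum_annihilator y (q + q) `<=` class_sum_annihilator y q.
Proof.
move=> q0 f [hf zf]; split=> // x c; rewrite degree_class_double fsum_setU.
- by rewrite !zf addr0.
- by rewrite -degree_class_double; exact: degree_class_finite.
- move=> h [[_ _ d] [_ _ d']]; apply: (dvdz_double q0).
  by have := rpredB d d'; have -> // : deg h - c - (deg h - (c + q)) = q by ring.
Qed.

End ArtinianImpliesFinite.

Section Periodic.
Variables (K : fieldType) (X : topologicalType) (S : dr_system X).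
Local Notation G := (dr_groupoid S).
Local Notation rng := (@dr_rng X S).
Local Notation src := (@dr_src X S).
Local Notation deg := (@dr_deg X S).
Local Notation A := (@steinberg K X S).
Local Notation conv := (@convolution K X S).

(** With [q n] the degree of the [2 ^ n]-th power of the loop [g], the ideals
    [class_sum_annihilator y (q n)] decrease, and the difference between the unit
    at [y] and the power of degree [q N] lies in the [N]-th ideal but not in the
    next one. *)
Lemma left_artinian_aperiodic (g : G) : finite_set [set: X] ->
  left_artinian conv A -> rng g = src g -> 0 < deg g -> False.
Proof.
move=> fX art rs d0; set y := rng g.
pose q n : int := deg g *+ (2 ^ n).
have q_gt0 n : 0 < q n by rewrite pmulrn_lgt0// expn_gt0.
have qS n : q n.+1 = q n + q n by rewrite /q expnS mul2n -addnn mulrnDr.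
have [|N NP] := art (fun n => class_sum_annihilator (K := K) y (q n))
    (fun n => class_sum_annihilator_left_ideal K S y (q n)).
  by move=> n; rewrite qS; exact: class_sum_annihilator_double.
have [t [rt st dt]] := isotropy_power (2 ^ N) rs.
pose e := unit_arrow S y.
pose f : G -> K := fun h => -1 * \1_[set t] h + \1_[set e] h.
have sum_f Q x c : \sum_(h \in degree_class y Q x c) f h =
    (e \in degree_class y Q x c)%:R - (t \in degree_class y Q x c)%:R.
  have fin (u : G) : finite_set
      (degree_class y Q x c `&` [set h | (\1_[set u] h : K) != 0]).
    apply: sub_finite_set (finite_set1 u) => h [_ /=]; rewrite indicE.
    by case: (boolP (h \in [set u])); rewrite ?inE ?eqxx.
  by rewrite fsum_linear// !fsum_indic1 mulN1r addrC.
have : class_sum_annihilator (K := K) y (q N) f.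
  split.
    have := steinberg_cons (-1 : K) (singleton_bisection t fX)
      (steinberg_indic 1 (singleton_bisection e fX)).
    by congr (A _); apply/funext => h; rewrite mul1r.
  move=> x c; rewrite sum_f; apply/eqP; rewrite subr_eq0; apply/eqP.
  congr (_%:R); congr nat_of_bool; apply/idP/idP; rewrite !inE => -[r s d].
    split=> //; first by rewrite rt.
    have -> : deg t - c = (deg e - c) + q N by rewrite dt add0r addrC.
    exact: rpredD d (dvdzz _).
  split=> //; first by rewrite -r rt.
  have -> : deg e - c = (deg t - c) - q N by rewrite dt addrAC subrr.
  exact: rpredB d (dvdzz _).
rewrite -(NP N.+1 (leqnSn N)) => -[_ /(_ y 0)]; rewrite sum_f.
have -> : e \in degree_class y (q N.+1) y 0.
  by rewrite inE; split=> //; rewrite subr0 dvdz0.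
have -> : (t \in degree_class y (q N.+1) y 0) = false.
  apply/negP; rewrite inE => -[_ _]; rewrite subr0 dt qS.
  exact: (dvdz_double (q_gt0 N)).
by move/eqP; rewrite subr0 oner_eq0.
Qed.

End Periodic.

(** * Semisimplicity for finite groupoids *)

Section MatrixUnits.
Variables (K : fieldType) (X : topologicalType) (S : dr_system X).
Local Notation G := (dr_groupoid S).
Local Notation rng := (@dr_rng X S).
Local Notation src := (@dr_src X S).
Local Notation deg := (@dr_deg X S).
Local Notation A := (@steinberg K X S).
Local Notation conv := (@convolution K X S).
Hypothesis fG : finite_set [set: G].

Let fX : finite_set [set: X] := finite_units fG.

Lemma sum_of_points (f : G -> K) :
  (fun h => \sum_(g <- fset_set [set: G]) f g * \1_[set g] h) = f.
Proof.
apply/funext => h.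
rewrite (big_fsetD1 h) ?in_fset_set ?inE//= big_seq big1 => [|g].
  by rewrite indicE mem_set// mulr1 addr0.
rewrite in_fsetD1 => /andP[gh _]; rewrite indicE memNset ?mulr0// => hg.
by move: gh; rewrite hg eqxx.
Qed.

(** Singletons of a finite Hausdorff groupoid are compact open bisections. *)
Lemma steinberg_full (f : G -> K) : A f.
Proof.
have As (s : seq G) : A (fun h => \sum_(g <- s) f g * \1_[set g] h).
  elim: s => [|g s IHs].
    have := @steinberg0 K X S; congr (A _); apply/funext => h.
    by rewrite big_nil.
  have := steinberg_cons (f g) (singleton_bisection g fX) IHs.
  by congr (A _); apply/funext => h; rewrite big_cons.
by rewrite -[f]sum_of_points.
Qed.

Lemma convolution_unit (a : G -> K) :
  conv \1_(range (unit_arrow S)) a = a /\ conv a \1_(range (unit_arrow S)) = a.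
Proof.
split; apply/funext => g.
  apply: (@convolution_indicl _ _ _ _ _ (unit_arrow S (rng g))).
  - by move=> u v; rewrite !inE => -[x _ <-] [y _ <-] /= e; congr unit_arrow.
  - by exists (rng g).
  - by split=> //; rewrite add0r.
apply: (@convolution_indicr _ _ _ _ _ _ (unit_arrow S (src g))).
- by move=> u v; rewrite !inE => -[x _ <-] [y _ <-] /= e; congr unit_arrow.
- by exists (src g).
- by split=> //; rewrite addr0.
Qed.

Definition column (y : X) : set (G -> K) :=
  [set f | forall g, f g != 0 -> src g = y].

Lemma columnP y f g : column y f -> src g <> y -> f g = 0.
Proof. by move=> cf gy; apply/eqP; apply: contrapT => /negP /cf. Qed.

Lemma column_left_ideal y : left_ideal conv A (column y).
Proof.
split; first split.
- by move=> f _; exact: steinberg_full.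
- by move=> g; rewrite eqxx.
- move=> f1 f2 h1 h2 g; rewrite !fctE => fg; apply: contrapT => gy.
  by move: fg; rewrite (columnP h1 gy) (columnP h2 gy) subrr eqxx.
- move=> a f _ hf g fg; apply: contrapT => gy; move: fg.
  rewrite convolutionE fsbig1 ?eqxx// => -[u v] [/= _ _ s _].
  by rewrite (columnP hf) ?mulr0// -s.
Qed.

(** In a principal groupoid a column has one entry for each range, so convolution
    with the singleton at [h g^-1] replaces an element [f] of the column by a
    multiple of the singleton at [h], nonzero as soon as [f g] is. *)
Lemma column_simple y : simple_left_ideal conv A (column y).
Proof.
split; first exact: column_left_ideal.
  move=> col0; have : column y (\1_[set unit_arrow S y] : G -> K).
    move=> g; rewrite indicE; case: (boolP (g \in _)); rewrite ?inE ?eqxx//.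
    by move=> ->.
  rewrite col0 => /(congr1 (@^~ (unit_arrow S y))) /=.
  by rewrite indicE mem_set// => /eqP; rewrite oner_eq0.
move=> I hI Icol; have [[IA I0 IB] IM] := hI.
have [[f [If [g fg]]]|nf] := pselect (exists f, I f /\ exists g, f g != 0); last first.
  left; apply/seteqP; split=> [f If|_ ->//]; apply/funext => g.
  by apply/eqP; apply: contrapT => /negP fg; apply: nf; exists f; split=> //; exists g.
right; apply/seteqP; split=> // b cb.
have gy := Icol _ If _ fg.
have single (h : G) : I (fun k => b h * \1_[set h] k).
  have [hy|hy] := eqVneq (src h) y; last first.
    suff -> : (fun k => b h * \1_[set h] k) = 0 :> (G -> K) by [].
    by apply/funext => k; rewrite (columnP cb) ?mul0r//; exact/eqP.
  have [u c] := composes_divr (etrans hy (esym gy)).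
  (* u is h g^-1 *)
  have := IM (fun k => (b h / f g) * \1_[set u] k) f (@steinberg_full _) If.
  rewrite convolutionZl; congr (I _); apply/funext => k.
  have [ru|ru] := eqVneq (rng k) (rng u); last first.
    rewrite convolution_indicl0 => [|_ -> e]; last by move: ru; rewrite e eqxx.
    rewrite indicE memNset ?mulr0// => kh; move: ru.
    by have [_ r _ _] := c; rewrite kh r eqxx.
  have [v cv] := composes_divl ru.
  rewrite (@convolution_indicl _ _ _ _ _ u v)//; last first.
    by move=> u1 u2; rewrite !inE => -> ->.
  have [e r s d] := cv; have [e' r' s' d'] := c.
  have [ky|ky] := eqVneq (src k) y; last first.
    rewrite (columnP (Icol _ If) (g := v)) ?mulr0; last by rewrite -s; exact/eqP.
    by rewrite indicE memNset ?mulr0// => kh; move: ky; rewrite kh hy eqxx.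
  have kh : k = h by apply: principal_ext => //; [rewrite r r'|rewrite ky hy].
  have vg : v = g by apply: (composes_injr (u := u) (g := k)) => //; rewrite kh.
  by rewrite vg indicE kh mem_set// mulr1 divfK.
have Is (s : seq G) : I (fun k => \sum_(h <- s) b h * \1_[set h] k).
  elim: s => [|h s IHs].
    by move: I0; congr (I _); apply/funext => k; rewrite big_nil.
  have := left_idealD hI (single h) IHs; congr (I _).
  by apply/funext => k; rewrite big_cons.
by rewrite -[b]sum_of_points.
Qed.

Lemma finite_groupoid_semisimple : semisimple conv A.
Proof.
split.
  exists (\1_(range (unit_arrow S))); first exact: steinberg_full.
  by move=> a _; exact: convolution_unit.
exists X, column; split=> [y|a _]; first exact: column_simple.
have ev (x : X -> G -> K) g :
    (\sum_(y \in [set: X]) x y) g = \sum_(y <- fset_set [set: X]) x y g.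
  by rewrite fsbig_finite// fct_sumE.
have col (x : X -> G -> K) g : (forall y, column y (x y)) ->
    \sum_(y <- fset_set [set: X]) x y g = x (src g) g.
  move=> cx; rewrite (big_fsetD1 (src g)) ?in_fset_set ?inE//= big_seq big1 ?addr0// => y.
  rewrite in_fsetD1 => /andP[yg _]; apply: (columnP (cx y)) => e.
  by move: yg; rewrite e eqxx.
pose x y : G -> K := fun g => if src g == y then a g else 0.
have cx y : column y (x y).
  by move=> g; rewrite /x; case: (eqVneq (src g) y) => // _; rewrite eqxx.
exists x; split.
  split=> //; first exact: sub_finite_set fX.
  by apply/funext => g; rewrite ev col// /x eqxx.
move=> x' [cx' _ ax']; apply/funext => y; apply/funext => g; rewrite /x.
have [gy|gy] := eqVneq (src g) y.
  by rewrite ax' ev col// gy.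
by rewrite (columnP (cx' y))//; exact/eqP.
Qed.

End MatrixUnits.

(** * The equivalence *)

Theorem proposition6p10 (K : fieldType) (X : topologicalType)
    (S : dr_system X) (X_td : totally_disconnected [set: X]) :
  [<-> finite_set [set: X] /\ iter_dom S #|` fset_set [set: X]| = set0;
       finite_set [set: dr_groupoid S];
       left_artinian (@convolution K X S) (@steinberg K X S);
       right_artinian (@convolution K X S) (@steinberg K X S);
       semisimple (@convolution K X S) (@steinberg K X S)].
Proof.
have left_right : left_artinian (@convolution K X S) (@steinberg K X S) <->
    right_artinian (@convolution K X S) (@steinberg K X S).
  apply: (left_right_artinian (phi := fun f => f \o (@dr_inv X S))) => //.
  - exact: inv_compK.
  - exact: convolution_inv.
  - exact: steinberg_inv.
have semi_art : semisimple (@convolution K X S) (@steinberg K X S) ->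
    left_artinian (@convolution K X S) (@steinberg K X S).
  apply: semisimple_left_artinian; first exact: steinbergB.
  by move=> a x y; exact: convolutionDr.
have art_nilp : left_artinian (@convolution K X S) (@steinberg K X S) ->
    finite_set [set: X] /\ iter_dom S #|` fset_set [set: X]| = set0.
  move=> art; have fX := left_artinian_finite X_td art; split=> //.
  apply: contrapT => /eqP/set0P /(periodic_point fX erefl) [g [rs d]].
  exact: left_artinian_aperiodic fX art rs d.
have nilp_fin : finite_set [set: X] /\ iter_dom S #|` fset_set [set: X]| = set0 ->
    finite_set [set: dr_groupoid S] by move=> [fX]; exact: finite_groupoid.
tfae.
- exact: nilp_fin.
- by move=> fG; apply: semi_art; exact: finite_groupoid_semisimple.
- by move/left_right.
- move=> /left_right art; apply: finite_groupoid_semisimple.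
  exact/nilp_fin/art_nilp.
- by move=> /semi_art.
Qed.
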